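(* Every planar graph containing no $3$-cycle, no $4$-cycle and no $6$-cycle (as subgraphs) is $(0,45)$-colorable, i.e., its vertex set can be partitioned into an independent set and a set inducing a subgraph of maximum degree at most $45$.
   Context: All graphs are finite and simple. *)

(* Defs.v *)
From mathcomp Require Import all_boot all_order all_algebra.
From mathcomp Require Import all_classical all_reals all_analysis.
Set Implicit Arguments.
Unset Strict Implicit.
Unset Printing Implicit Defensive.

Import Order.TTheory GRing.Theory Num.Theory.
Import numFieldNormedType.Exports.
Local Open Scope classical_set_scope.
Local Open Scope ring_scope.

(* A drawing without crossings of the graph [e] in the plane [R * R].  Each
   edge is given once per orientation; [pd_rev] makes [arc u v] and [arc v u]
   the same curve traversed in opposite directions.  The values of [arc] on
   non-edges and outside `[0, 1] are irrelevant. *)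
Record plane_drawing (R : realType) (T : finType) (e : rel T)
    (pos : T -> R * R) (arc : T -> T -> R -> R * R) : Prop := PlaneDrawing {
  pd_pos_inj : injective pos ;
  pd_cont : forall u v, e u v -> {within `[0, 1], continuous (arc u v)} ;
  pd_inj : forall u v, e u v -> {in `[0, 1] &, injective (arc u v)} ;
  pd_src : forall u v, e u v -> arc u v 0 = pos u ;
  pd_tgt : forall u v, e u v -> arc u v 1 = pos v ;
  pd_rev : forall u v, e u v ->
    {in `[0, 1], forall t, arc v u t = arc u v (1 - t)} ;
  pd_avoid : forall u v w, e u v -> {in `]0, 1[, forall t, arc u v t <> pos w} ;
  pd_disj : forall u v x y, e u v -> e x y ->
    {in `]0, 1[ &, forall s t, arc u v s = arc x y t ->
      (u = x /\ v = y) \/ (u = y /\ v = x)}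
}.

Definition planar (R : realType) (T : finType) (e : rel T) : Prop :=
  exists (pos : T -> R * R) (arc : T -> T -> R -> R * R),
    plane_drawing e pos arc.

(* Meaningful for [3 <= k] only: [ucycle] accepts an edge as a 2-cycle. *)
Definition has_kcycle (T : finType) (e : rel T) (k : nat) : Prop :=
  exists c : seq T, ucycle e c /\ size c = k.

Definition independent (T : finType) (e : rel T) (A : {set T}) : Prop :=
  {in A &, forall u v, ~~ e u v}.

Definition induced_maxdeg (T : finType) (e : rel T) (B : {set T}) : nat :=
  (\max_(v in B) #|[set w in B | e v w]%SET|)%N.

Definition colorable0 (T : finType) (e : rel T) (d : nat) : Prop :=
  exists A : {set T}, independent e A /\ (induced_maxdeg e (~: A)%SET <= d)%N.

(* Main.v *)
(** Let [G] be a minimal counterexample. Its vertices have degree at least 2, and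
    every vertex of degree at most 46 has a neighbour of degree at least 47,
    since otherwise a colouring of [G - v] extends to [v], after moving the
    saturated neighbours of [v] into the independent set.

    Planarity is used through MacLane's property: the cycle space of [G] over
    F_2 is spanned by a family of faces covering every edge at most twice, so
    the number of faces is at least [|E| - |V|]. To obtain it without the Jordan
    curve theorem, the arcs are replaced by polygons and, for a cycle [C] and a
    point [p], the parity [w(C, p)] of the number of crossings of [C] with a
    vertical ray from [p] is considered. The two sides of an edge give two linear
    functionals on the cycle space whose difference is [C |-> (edge in C)]; a
    face is the set of edges that have a given functional on exactly one side.

    As [G] has no cycle of length 3, 4 or 6, a nonzero element of the cycle space
    is a 5-cycle or has at least 7 edges, and two distinct 5-cycles cannot share
    both edges at a vertex of degree 2. A discharging argument, in which vertices
    of degree at least 47 pay for their small neighbours and for 5-cycles, then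
    contradicts the count of faces. *)
From mathcomp Require Import all_boot zify.
Set Implicit Arguments.
Unset Strict Implicit.
Unset Printing Implicit Defensive.

(** * Cycle space and faces *)

Section Parity.
Variable T : finType.
Implicit Types (A B : {set T}) (P Q : pred T).

Definition symdiff A B := [set x | (x \in A) (+) (x \in B)].

(** Written as sums in F_2, parities are additive through [big_split], and double counting becomes
    an exchange of sums. *)
Lemma odd_cardE P : odd #|P| = \big[addb/false]_x P x.
Proof.
rewrite -sum1_card (big_morph odd oddD (erefl : odd 0 = false)) big_mkcond.
by apply: eq_bigr => x _; rewrite unfold_in; case: (P x).
Qed.

Lemma odd_card_setE P : odd #|[set x | P x]| = \big[addb/false]_x P x.
Proof. by rewrite cardsE odd_cardE. Qed.

Lemma symdiff_eq0 A B : (symdiff A B == set0) = (A == B).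
Proof.
apply/eqP/eqP => [/setP h|->]; apply/setP => x; last by rewrite !inE addbb.
by have := h x; rewrite !inE; do 2 case: (_ \in _).
Qed.

Lemma symdiffK A B : symdiff (symdiff A B) B = A.
Proof. by apply/setP => x; rewrite !inE -addbA addbb addbF. Qed.

Lemma card_symdiff A B : #|symdiff A B| + #|A :&: B|.*2 = #|A| + #|B|.
Proof.
have -> : symdiff A B = (A :\: B) :|: (B :\: A).
  by apply/setP => x; rewrite !inE; do 2 case: (_ \in _).
rewrite cardsU (_ : (A :\: B) :&: (B :\: A) = set0) ?cards0 ?subn0; last first.
  by apply/setP => x; rewrite !inE; do 2 case: (_ \in _).
have := cardsID B A; have := cardsID A B; rewrite (setIC B A).
rewrite -addnn; lia.
Qed.

End Parity.

(** * The cycle space over F_2 and a lower bound on its size *)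

Section CycleSpace.
Variables (T : finType) (e : rel T).
Hypotheses (e_sym : symmetric e) (e_irr : irreflexive e).

Definition edges : {set {set T}} :=
  [set [set p.1; p.2] | p : T * T & e p.1 p.2].

(** Edges are two-element sets, so an element of this space is the edge set of a subgraph with all
    degrees even. *)
Definition cycle_space : {set {set {set T}}} :=
  [set C : {set {set T}} | (C \subset edges) &&
     [forall v, ~~ odd #|[set x in C | v \in x]|]].

Lemma edgesP x : reflect (exists u v, e u v /\ x = [set u; v]) (x \in edges).
Proof.
apply: (iffP imsetP) => [[[u v]]|[u [v [uv ->]]]].
  by rewrite inE /= => uv ->; exists u, v.
by exists (u, v); rewrite ?inE.
Qed.

Lemma mem_edges u v : ([set u; v] \in edges) = e u v.
Proof.
apply/edgesP/idP => [[a [b [ab /setP h]]]|uv]; last by exists u, v.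
have nab : a != b by apply: contraTneq ab => ->; rewrite e_irr.
have := h a; have := h b; have := h u; have := h v.
rewrite !inE !eqxx /= ?orbT => /esym hv /esym hu /orP hb /orP ha.
case: ha => /eqP ha; case: hb => /eqP hb; subst.
- by rewrite eqxx in nab.
- by [].
- by rewrite e_sym.
- by rewrite eqxx in nab.
Qed.

Lemma edge_inj (u v w : T) : [set u; v] = [set u; w] -> v = w.
Proof.
move/setP => h; have := h v; have := h w; rewrite !inE !eqxx !orbT.
case/orP=> /eqP -> //; by rewrite orbb => /esym/eqP.
Qed.

Lemma edge_at v (x : {set T}) : v \in x -> x \in edges -> exists2 u, e v u & x = [set v; u].
Proof.
move=> vx /edgesP[a [b [ab ?]]]; subst x; move: vx; rewrite !inE.
case/orP => /eqP ->; first by exists b.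
by exists a; rewrite 1?e_sym // setUC.
Qed.

Lemma edge_card (x : {set T}) : x \in edges -> #|x| = 2.
Proof.
case/edgesP=> a [b [ab ->]]; rewrite cards2.
by case: eqP => // E; rewrite E e_irr in ab.
Qed.

Lemma incident_image (C : {set {set T}}) v : C \subset edges ->
  [set x in C | v \in x] = [set [set v; u] | u in [set u | [set v; u] \in C]].
Proof.
move/subsetP => CE; apply/setP => x; rewrite inE; apply/andP/imsetP.
  case=> xC vx; have [u _ E] := edge_at vx (CE _ xC).
  by exists u; rewrite ?inE -?E.
by case=> u; rewrite inE => ? ->; rewrite !inE eqxx.
Qed.

Lemma card_incident (C : {set {set T}}) v : C \subset edges ->
  #|[set x in C | v \in x]| = #|[set u | [set v; u] \in C]|.
Proof.
move=> /incident_image ->; rewrite card_in_imset // => u w _ _; exact: edge_inj.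
Qed.

Lemma cycle_spaceP (C : {set {set T}}) : reflect (C \subset edges /\
    forall v, ~~ odd #|[set u | [set v; u] \in C]|) (C \in cycle_space).
Proof.
rewrite inE; apply: (iffP andP) => -[CE].
  by move/forallP => h; split=> // v; rewrite -card_incident.
by move=> h; split=> //; apply/forallP => v; rewrite card_incident.
Qed.

Lemma cycle_space_symdiff (C D : {set {set T}}) :
  C \in cycle_space -> D \in cycle_space -> symdiff C D \in cycle_space.
Proof.
move=> /cycle_spaceP[/subsetP CE hC] /cycle_spaceP[/subsetP DE hD]; apply/cycle_spaceP; split.
  apply/subsetP => x; rewrite inE.
  by case xC: (x \in C) => /=; [move=> _; apply: CE | apply: DE].
move=> v; have := hC v; have := hD v; rewrite !odd_card_setE.
under [in X in _ -> _ -> X]eq_bigr do rewrite inE.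
by rewrite big_split /=; do 2 case: (\big[_/_]_(_ | _) _).
Qed.

Variable S : {set T}.
Hypothesis eS : forall u v, e u v -> u \in S.

(* Fibres of the boundary map are cosets of the cycle space. *)
Lemma card_cycle_space : 2 ^ #|edges| <= #|cycle_space| * 2 ^ #|S|.
Proof.
pose bd (C : {set {set T}}) := [set v | odd #|[set u | [set v; u] \in C]|].
rewrite -card_powerset -[2 ^ #|S|]card_powerset mulnC -sum_nat_const.
rewrite -sum1_card (partition_big bd [in powerset S]) /=; last first.
  move=> C; rewrite !inE => /subsetP CE; apply/subsetP => v; rewrite inE.
  case: (set_0Vmem [set u | [set v; u] \in C]) => [->|[u]]; first by rewrite cards0.
  by rewrite inE => /CE; rewrite mem_edges => /eS.
apply: leq_sum => A _; rewrite sum1dep_card.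
case: (set_0Vmem [set C in powerset edges | bd C == A]) => [->|[C0]].
  by rewrite cards0.
rewrite inE => /andP[]; rewrite inE => C0E /eqP C0A.
rewrite -(card_imset _ (f := fun C => symdiff C C0)); last first.
  exact: can_inj (fun C => symdiff C C0) (fun C => symdiffK C C0).
apply/subset_leq_card/subsetP => _ /imsetP[C + ->].
rewrite inE => /andP[]; rewrite inE => CE /eqP CA; apply/cycle_spaceP; split.
  apply/subsetP => x; rewrite inE; case xC: (x \in C) => /=.
    by move=> _; apply: (subsetP CE).
  by move/(subsetP C0E).
move=> v; have /setP/(_ v) : bd C = bd C0 by rewrite CA.
rewrite !inE !odd_card_setE.
under [in X in _ -> X]eq_bigr do rewrite inE.
by rewrite big_split /=; do 2 case: (\big[_/_]_(_ | _) _).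
Qed.

End CycleSpace.

(** * MacLane's property from functionals attached to the sides of edges *)

Section MacLane.
Variables (T : finType) (e : rel T).
Hypotheses (e_sym : symmetric e) (e_irr : irreflexive e).
Local Notation functional := {ffun {set {set T}} -> bool}.

(** The value is fixed to [false] off the cycle space, so that functionals agreeing on all cycles
    are equal and can index the faces. *)
Definition restr (phi : {set {set T}} -> bool) : functional :=
  [ffun C => (C \in cycle_space e) && phi C].

(** Passing through the edge [uv] changes the winding parity exactly for the cycles that use this
    edge. *)
Definition other_side (phi : T -> T -> {set {set T}} -> bool) u v C :=
  phi u v C (+) ([set u; v] \in C).

Variable phi : T -> T -> {set {set T}} -> bool.
Let r u v := restr (phi u v).
Let r' u v := restr (other_side phi u v).

Hypothesis phi_lin : forall u v C D,
  phi u v (symdiff C D) = phi u v C (+) phi u v D.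
Hypothesis phi_off : forall u v C, e u v -> C \in cycle_space e -> [set u; v] \notin C ->
  phi u v C = phi v u C.
(** In a turn around [v], each sector is a side of the two edges that bound it, so every functional
    occurs an even number of times among the sides at [v]. *)
Hypothesis phi_even : forall v (f : functional),
  \big[addb/false]_(u | e v u) ((r v u == f) (+) (r' v u == f)) = false.

Let edgeC (u v : T) : [set u; v] = [set v; u]. Proof. exact: setUC. Qed.

(** The difference of [phi u v] and [phi v u] is linear and vanishes on the cycles avoiding [uv]. It
    is therefore zero or the functional testing whether [uv] lies in the cycle; its value at one
    cycle [C0] through [uv] decides which. *)
Lemma sides_swap u v : e u v ->
  (r u v = r v u /\ r' u v = r' v u) \/ (r u v = r' v u /\ r' u v = r v u).
Proof.
move=> uv.
have offE C : C \in cycle_space e -> [set u; v] \notin C -> phi u v C = phi v u C.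
  exact: phi_off.
have [C0 /andP[C0c uvC0]|none] := pickP [pred C in cycle_space e | [set u; v] \in C].
  have onE C : C \in cycle_space e -> [set u; v] \in C ->
      phi u v C = phi v u C (+) (phi u v C0 (+) phi v u C0).
    move=> Cc uvC; have := offE (symdiff C C0) (cycle_space_symdiff e_sym Cc C0c).
    rewrite inE uvC uvC0 => /(_ isT); rewrite !phi_lin.
    by do 4 case: (phi _ _ _).
  case D: (phi u v C0 (+) phi v u C0); [right|left]; split; apply/ffunP => C;
    rewrite !ffunE /other_side ?(edgeC v u);
    case Cc: (C \in cycle_space e) => //=; case uvC: ([set u; v] \in C);
    rewrite ?(onE _ Cc uvC) ?(offE _ Cc (negbT uvC)) ?D ?addbF ?addbT ?negbK //.
left; split; apply/ffunP => C; rewrite !ffunE /other_side ?(edgeC v u);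
  case Cc: (C \in cycle_space e) => //=; have := none C; rewrite /= Cc /= => uvC;
  by rewrite ?uvC (offE _ Cc (negbT uvC)).
Qed.

Definition face (f : functional) : {set {set T}} :=
  [set x in edges e | [exists p : T * T, (x == [set p.1; p.2]) &&
     ((r p.1 p.2 == f) (+) (r' p.1 p.2 == f))]].

Lemma mem_face u v f : e u v ->
  ([set u; v] \in face f) = (r u v == f) (+) (r' u v == f).
Proof.
move=> uv; rewrite inE mem_edges // uv /=; apply/existsP/idP; last first.
  by move=> h; exists (u, v); rewrite eqxx.
case=> -[a b] /= /andP[/eqP E]; have : [set a; b] \in edges e by rewrite -E mem_edges.
have : u \in [set a; b] by rewrite -E !inE eqxx.
rewrite !inE => /orP[] /eqP ? _; subst.
  by have <- := edge_inj E.
rewrite (edgeC a) in E; have ? := edge_inj E; subst.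
case: (sides_swap uv) => -[-> ->] //.
by rewrite addbC.
Qed.

Lemma face_cycle_space f : face f \in cycle_space e.
Proof.
apply/(cycle_spaceP e_sym _); split; first by apply/subsetP => x; rewrite inE => /andP[].
move=> v; rewrite odd_card_setE; apply/negbT.
rewrite -[RHS](phi_even v f) [RHS]big_mkcond /=; apply: eq_bigr => u _.
case vu: (e v u); first by rewrite mem_face.
by rewrite inE mem_edges // vu.
Qed.

(** On an edge [uv] the sum over all functionals keeps only the two sides, [r u v C (+) r' u v C],
    which is the membership of [uv] in [C] by definition of [other_side]. *)
Lemma cycle_space_span C x : C \in cycle_space e -> x \in edges e ->
  (x \in C) = \big[addb/false]_(f : functional) (f C && (x \in face f)).
Proof.
move=> Cc /edgesP[u [v [uv ->]]].
under eq_bigr do rewrite mem_face // andb_addr.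
have pickE (g : functional) : \big[addb/false]_(f : functional) (f C && (g == f)) = g C.
  rewrite (bigD1 g) //= eqxx andbT big1 ?addbF // => f /negbTE.
  by rewrite eq_sym => ->; rewrite andbF.
by rewrite big_split /= !pickE !ffunE Cc /= addbA addbb.
Qed.

(** The faces are the nonempty sets [face f]. An edge lies only in the faces of its two sides. As
    the faces span, the cycle space has at most [2 ^ #|BB|] elements, to be compared with
    [card_cycle_space]. *)
Lemma face_family (S : {set T}) : (forall u v, e u v -> u \in S) ->
  exists BB : {set {set {set T}}},
  [/\ {in BB, forall B, B \in cycle_space e /\ B != set0},
      forall x, x \in edges e -> #|[set B in BB | x \in B]| <= 2 &
      #|edges e| <= #|BB| + #|S|].
Proof.
move=> eS; pose BB := [set face f | f : functional] :\ set0; exists BB; split.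
- by move=> B /setD1P[B0 /imsetP[f _ E]]; split=> //; rewrite E face_cycle_space.
- move=> _ /edgesP[u [v [uv ->]]].
  apply: (@leq_trans #|[set face (r u v); face (r' u v)]|); last first.
    by rewrite cards2; case: (_ != _).
  apply/subset_leq_card/subsetP => B; rewrite inE => /andP[/setD1P[_ /imsetP[f _ ->]]].
  rewrite mem_face // !inE; case: eqP => [<-|_ /=]; first by rewrite eqxx.
  by move/eqP => <-; rewrite eqxx orbT.
(* Different functionals may have the same face, so the coefficient of a face [X] in [C] is the
   parity of the number of contributing functionals with face [X]. *)
pose M (C : {set {set T}}) :=
  [set X in BB | odd #|[set f : functional | f C && (face f == X)]|].
have ME C x : C \in cycle_space e -> x \in edges e ->
    (x \in C) = odd #|[set X in M C | x \in X]|.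
  move=> Cc xE; rewrite (cycle_space_span Cc xE) odd_card_setE.
  transitivity (\big[addb/false]_(X : {set {set T}})
      \big[addb/false]_(f : functional) ((f C && (x \in face f)) && (face f == X))).
    rewrite exchange_big /=; apply: eq_bigr => f _.
    rewrite (bigD1 (face f)) //= eqxx andbT big1 ?addbF // => X /negbTE.
    by rewrite eq_sym => ->; rewrite andbF.
  apply: eq_bigr => X _; rewrite inE odd_card_setE.
  case xX: (x \in X); rewrite ?andbT ?andbF; last first.
    apply: big1 => f _; case: eqP => [->|]; by rewrite ?xX ?andbF.
  case XBB: (X \in BB) => /=.
    apply: eq_bigr => f _; case: eqP => [->|]; by rewrite ?xX ?andbT ?andbF.
  apply: big1 => f _; case: eqP => [E|]; rewrite ?andbF //.
  move/negbT: XBB; rewrite in_setD1 -E imset_f // andbT negbK => /eqP E0.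
  by rewrite -E E0 inE in xX.
have Minj : {in cycle_space e &, injective M}.
  move=> C D Cc Dc E; apply/setP => x; case xE: (x \in edges e).
    by rewrite (ME C) // (ME D) // E.
  have sub X : X \in cycle_space e -> x \in X = false.
    by case/(cycle_spaceP e_sym _) => /subsetP XE _; apply: contraFF xE => /XE.
  by rewrite !sub.
have := card_cycle_space e_sym e_irr eS; rewrite -(card_in_imset Minj).
have /subset_leq_card : M @: cycle_space e \subset powerset BB.
  by apply/subsetP => _ /imsetP[C _ ->]; rewrite inE; apply/subsetP => X; rewrite inE => /andP[].
rewrite card_powerset => h1 h2; rewrite -(leq_exp2l (m := 2)) // expnD.
by apply: leq_trans h2 _; rewrite leq_mul2r h1 orbT.
Qed.

End MacLane.

(** * Cancellation of the sectors around a vertex *)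

Section Telescope.
Variables (T : finType) (gt : rel T).

(* [K] plays the role of the functional on the first sector; each [u] in [G]
   separates the sectors [K + sum of those above u] and the same plus [x u]. *)
Lemma telescope_sides (X : finType) (x : T -> X -> bool) (Z : pred X)
    (f : {ffun X -> bool}) (n : nat) :
  forall (G : {set T}) (K : X -> bool), #|G| = n ->
  irreflexive gt -> {in G & &, transitive gt} ->
  {in G &, forall u v, [|| u == v, gt u v | gt v u]} ->
  let R (h : X -> bool) := [ffun C => Z C && h C] : {ffun X -> bool} in
  let h u C := K C (+) \big[addb/false]_(w in G | gt w u) x w C in
  \big[addb/false]_(u in G)
     ((R (h u) == f) (+) (R (fun C => h u C (+) x u C) == f)) =
  (R K == f) (+) (R (fun C => K C (+) \big[addb/false]_(w in G) x w C) == f).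
Proof.
elim: n => [|n IH] G K Gn girr gtr gtot R h.
  have -> : G = set0 by apply/eqP; rewrite -cards_eq0 Gn.
  rewrite big_set0.
  rewrite [X in _ = _ (+) (X == _)](_ : _ = R K) ?addbb //.
  by apply/ffunP => C; rewrite !ffunE big_set0 addbF.
(* Induction removes the topmost element [m]: its two sides are [K] and [K'], and the remaining
   elements telescope from [K']. *)
have [m mG mmax] : exists2 m, m \in G & {in G, forall w, ~~ gt w m}.
  have [u0 u0G] : exists u, u \in G by apply/card_gt0P; rewrite Gn.
  pose m := [arg min_(u < u0 in G) #|[set w in G | gt w u]|]; exists m.
    by rewrite /m; case: arg_minnP.
  rewrite /m; case: arg_minnP => // a aG amin w wG; apply/negP => wa.
  have := amin w wG; rewrite leqNgt => /negP; apply; apply/proper_card/properP; split.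
    by apply/subsetP => z; rewrite !inE => /andP[zG zw]; rewrite zG /= (gtr w).
  by exists w; rewrite !inE wG ?girr.
have mgt w : w \in G -> w != m -> gt m w.
  move=> wG wm; have := gtot w m wG mG; rewrite (negbTE wm) /=.
  by rewrite (negbTE (mmax _ wG)).
pose K' C := K C (+) x m C.
have G'n : #|G :\ m| = n by have := cardsD1 m G; rewrite mG Gn => -[].
have := IH (G :\ m) K' G'n girr.
have gtr' : {in G :\ m & &, transitive gt}.
  by move=> b a c /setD1P[_ bG] /setD1P[_ aG] /setD1P[_ cG]; apply: gtr.
move=> /(_ gtr')/= IH'; rewrite (bigD1 m mG) /=.
have hm : R (h m) = R K.
  apply/ffunP => C; rewrite !ffunE /h big_pred0 ?addbF // => w.
  by apply/andP => -[wG]; apply/negP/mmax.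
have hm' : R (fun C => h m C (+) x m C) = R K'.
  apply/ffunP => C; rewrite !ffunE /h big_pred0 ?addbF // => w.
  by apply/andP => -[wG]; apply/negP/mmax.
rewrite hm hm'.
pose h' u C := K' C (+) \big[addb/false]_(w in G :\ m | gt w u) x w C.
have hh' u C : u \in G -> u != m -> h u C = h' u C.
  move=> uG um; rewrite /h /h' (bigD1 m) /=; last by rewrite mG mgt.
  rewrite addbA; congr (_ (+) _); apply: eq_bigl => w; rewrite !inE.
  by rewrite andbC andbA.
have Rext (a b : X -> bool) : a =1 b -> R a = R b.
  by move=> ab; apply/ffunP => C; rewrite !ffunE ab.
have -> : \big[addb/false]_(i in G | i != m)
    ((R (h i) == f) (+) (R (fun C : X => h i C (+) x i C) == f)) =
   \big[addb/false]_(i in G :\ m)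
    ((R (h' i) == f) (+) (R (fun C : X => h' i C (+) x i C) == f)).
  apply: eq_big => [i|i /andP[iG im]]; first by rewrite !inE andbC.
  rewrite (Rext _ _ (fun C => hh' i C iG im)).
  by rewrite (Rext (fun C => h i C (+) x i C) (fun C => h' i C (+) x i C)) // => C; rewrite hh'.
rewrite IH'; last by move=> u v /setD1P[_ uG] /setD1P[_ vG]; apply: gtot.
rewrite -addbA; congr (_ (+) _); rewrite addbA addbb /=; congr (_ == _).
by apply: Rext => C; rewrite (big_setD1 m mG) /= addbA.
Qed.

End Telescope.

(** * Colouring *)

Section Cycles.
Variable T : finType.

(** The first vertex [x] of a longest path has a neighbour [w] besides its successor [y]. By
    maximality [w] lies on the path, and closing up at [w] gives a cycle with at least three
    vertices. *)
Lemma exists_ucycle (r : rel T) : symmetric r -> irreflexive r ->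
  (forall v u, r v u -> exists2 w, w != u & r v w) ->
  forall a b, r a b -> exists c, ucycle r c /\ 2 < size c.
Proof.
move=> rsym rirr mindeg a b ab.
pose P n := [exists x, [exists p : n.-tuple T, path r x p && uniq (x :: p)]].
have Pex : exists n, P n.
  exists 1; apply/existsP; exists a; apply/existsP; exists [tuple b].
  by rewrite /= ab !inE !andbT; apply: contraTneq ab => ->; rewrite rirr.
have Pub n : P n -> n <= #|T|.
  case/existsP=> x /existsP[p /andP[_ /card_uniqP E]].
  by apply: leq_trans (max_card (mem (x :: p))); rewrite E /= size_tuple leqnSn.
case: (ex_maxnP Pex Pub) => n /existsP[x /existsP[[p /= /eqP pn] /andP[/= pp up]]] nmax.
have n1 : 0 < n.
  apply: nmax; apply/existsP; exists a; apply/existsP; exists [tuple b].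
  by rewrite /= ab !inE !andbT; apply: contraTneq ab => ->; rewrite rirr.
case: p pn pp up => [|y p] /= pn; first by rewrite -pn in n1.
case/andP=> xy pp up; have [w wy xw] := mindeg x y xy.
have wx : w != x by apply: contraTneq xw => ->; rewrite rirr.
have wp : w \in p.
  apply/negPn/negP => wp; suff /nmax : P n.+1 by rewrite ltnn.
  apply/existsP; exists w; apply/existsP.
  have sz : size [:: x, y & p] == n.+1 by rewrite -pn.
  exists (Tuple sz); rewrite /= rsym xw xy pp /=.
  by move: up => /= ->; rewrite !inE (negbTE wx) (negbTE wy) (negbTE wp).
case/splitPr: wp pp up {pn} => p1 p2 pp up.
exists [:: x, y & rcons p1 w]; split; last by rewrite /= size_rcons.
move: pp up; rewrite -cat_rcons cat_path => /andP[pp _].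
rewrite -[X in is_true X -> _]/(uniq ([:: x, y & rcons p1 w] ++ p2)).
rewrite cat_uniq => /andP[up _]; apply/andP; split=> //.
rewrite /= xy rcons_path pp /= last_rcons rsym.
exact: xw.
Qed.

Lemma next_next_neq (c : seq T) x : uniq c -> 2 < size c -> x \in c ->
  next c (next c x) != x.
Proof.
move=> Uc sc xc; case: (rot_to xc) => i c' E.
rewrite -!(next_rot i Uc) E; move: Uc sc.
rewrite -(rot_uniq i) -(size_rot i) E; case: c' {E} => [|y [|z s]] //= + _.
rewrite !inE !negb_or eqxx -!andbA => /and5P[xy xz _ yz _].
by rewrite [y == x]eq_sym (negbTE xy) eqxx eq_sym.
Qed.

Definition edge_rel (C : {set {set T}}) : rel T := fun u v => [set u; v] \in C.

Definition cycle_edges (c : seq T) : {set {set T}} :=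
  [set [set x; next c x] | x in c].

Lemma card_cycle_edges c : uniq c -> 2 < size c -> #|cycle_edges c| = size c.
Proof.
move=> Uc sc; rewrite card_in_imset ?(card_uniqP Uc) // => x y xc yc E.
have : x \in [set y; next c y] by rewrite -E !inE eqxx.
rewrite !inE => /orP[/eqP //|/eqP xny].
have : y \in [set x; next c x] by rewrite E !inE eqxx.
rewrite !inE => /orP[/eqP //|/eqP ynx].
by have := next_next_neq Uc sc xc; rewrite -ynx -xny eqxx.
Qed.

Lemma cycle_edges_even c v : uniq c -> 2 < size c ->
  ~~ odd #|[set u | [set v; u] \in cycle_edges c]|.
Proof.
move=> Uc sc; have -> : [set u | [set v; u] \in cycle_edges c] =
    if v \in c then [set next c v; prev c v] else set0.
  apply/setP => u; rewrite inE; apply/imsetP/idP.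
    case=> x xc E; have : v \in [set x; next c x] by rewrite -E !inE eqxx.
    rewrite !inE => /orP[] /eqP ?; subst v.
      by rewrite xc (edge_inj E) !inE eqxx.
    rewrite mem_next xc prev_next //; rewrite [RHS]setUC in E.
    by rewrite -(edge_inj E) !inE eqxx orbT.
  case: ifP => vc; rewrite ?inE //.
  case/orP=> /eqP ->; first by exists v.
  by exists (prev c v); rewrite ?mem_prev // next_prev // setUC.
case: ifP => vc; last by rewrite cards0.
rewrite cards2; case: eqP => // E.
by have := next_next_neq Uc sc vc; rewrite E next_prev // eqxx.
Qed.

End Cycles.

(** * Small elements of the cycle space *)

Section ShortCycles.
Variables (T : finType) (e : rel T).
Hypotheses (e_sym : symmetric e) (e_irr : irreflexive e).

Lemma edge_rel_sub (C : {set {set T}}) :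
  C \in cycle_space e -> forall u v, edge_rel C u v -> e u v.
Proof.
by case/(cycle_spaceP e_sym) => /subsetP CE _ u v /CE; rewrite mem_edges.
Qed.

(** No vertex has degree 1 in an even edge set, so [exists_ucycle] applies inside [C]. *)
Lemma cycle_space_ucycle (C : {set {set T}}) : C \in cycle_space e -> C != set0 ->
  exists c, [/\ ucycle (edge_rel C) c, 2 < size c, cycle_edges c \in cycle_space e &
               cycle_edges c \subset C].
Proof.
move=> Cc /set0Pn[x xC]; have eC := edge_rel_sub Cc.
have /(cycle_spaceP e_sym)[/subsetP CE Ceven] := Cc.
have /edgesP[a [b [ab xab]]] := CE _ xC; rewrite xab in xC.
have [c [uc sc]] : exists c, ucycle (edge_rel C) c /\ 2 < size c.
  apply: (exists_ucycle _ _ _ xC) => [u v|u|v u vu].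
  - by rewrite /edge_rel setUC.
  - by apply/negP => /eC; rewrite e_irr.
  have : 1 < #|[set w | [set v; w] \in C]|.
    have : 0 < #|[set w | [set v; w] \in C]| by apply/card_gt0P; exists u; rewrite inE.
    by have := Ceven v; case: #|_| => [|[]].
  case/card_gt1P => w1 [w2 []]; rewrite !inE => h1 h2 n12.
  case: (eqVneq w1 u) => [E|]; last by exists w1.
  by exists w2 => //; rewrite -E eq_sym.
have /andP[cc Uc] := uc.
have sub : cycle_edges c \subset C.
  apply/subsetP => _ /imsetP[y yc ->]; exact: (next_cycle cc yc).
exists c; split=> //; apply/(cycle_spaceP e_sym); split.
  by apply: subset_trans sub _; apply/subsetP.
by move=> v; apply: cycle_edges_even.
Qed.

Hypothesis no_short : forall c, ucycle e c -> size c != 3 /\ size c != 4 /\ size c != 6.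

(** [C] contains a cycle with 5 or at least 7 edges. If [C] has at most 6 edges, removing that
    5-cycle leaves an element with at most one edge, which must be empty since a nonempty element
    contains a cycle. *)
Lemma cycle_space_card (C : {set {set T}}) : C \in cycle_space e -> C != set0 ->
  6 < #|C| \/ #|C| = 5 /\ exists2 c, ucycle (edge_rel C) c & size c = 5.
Proof.
move=> Cc C0; have [c [uc sc Dc sub]] := cycle_space_ucycle Cc C0.
have uce : ucycle e c.
  case/andP: (uc) => cc Uc; apply/andP; split=> //.
  exact: (sub_cycle (edge_rel_sub Cc)) cc.
have [n3 [n4 n6]] := no_short uce; have /andP[cc Uc] := uc.
have cD := card_cycle_edges Uc sc; have := subset_leq_card sub; rewrite cD => le.
case: (ltnP 6 #|C|) => [|C6]; [by left|right].
have c5 : size c = 5 by lia.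
have [E|CD] := eqVneq (symdiff C (cycle_edges c)) set0.
  move/eqP: E; rewrite symdiff_eq0 => /eqP E; rewrite E cD c5; split=> //.
  by exists c; rewrite -?E.
have [c' [/andP[_ Uc'] sc' _ /subset_leq_card]] :=
  cycle_space_ucycle (cycle_space_symdiff e_sym Cc Dc) CD.
rewrite card_cycle_edges // => le'.
have := card_symdiff C (cycle_edges c).
have /setIidPr -> := sub; rewrite cD c5 -addnn; lia.
Qed.

End ShortCycles.

(** * Discharging *)

Section Discharging.
Variables (T : finType) (e : rel T) (S : {set T}).
Hypotheses (e_sym : symmetric e) (e_irr : irreflexive e).
Hypothesis eS : forall u v, e u v -> u \in S.
Hypothesis no_short : forall c, ucycle e c -> size c != 3 /\ size c != 4 /\ size c != 6.

Definition nbh v := [set w | e v w].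
Definition big_vertex v := 46 < #|nbh v|.
Definition big_nbh v := [set w in nbh v | big_vertex w].
Definition small_nbh v := [set w in nbh v | ~~ big_vertex w].

Hypothesis deg_ge2 : {in S, forall v, 1 < #|nbh v|}.
Hypothesis small_has_big : {in S, forall v, ~~ big_vertex v -> 0 < #|big_nbh v|}.

Variable BB : {set {set {set T}}}.
Hypothesis BB_cyc : {in BB, forall B, B \in cycle_space e /\ B != set0}.
Hypothesis BB_two : forall x, x \in edges e -> #|[set B in BB | x \in B]| <= 2.

Let F5 := [set B in BB | #|B| == 5].

Lemma card_nbh v : #|nbh v| = #|big_nbh v| + #|small_nbh v|.
Proof.
rewrite -(cardsID [set w | big_vertex w]); congr (_ + _); apply: eq_card => w.
  by rewrite !inE.
by rewrite !inE andbC.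
Qed.

(** Double counting of pairs (face, edge at [v]): each edge lies in at most two faces. *)
Lemma sum_nbh (Q : pred T) v :
  \sum_(B in F5) #|[set w | ([set v; w] \in B) && Q w]| <=
  2 * #|[set w in nbh v | Q w]|.
Proof.
under eq_bigr do rewrite -sum1dep_card big_mkcond /=.
rewrite exchange_big /= -sum1dep_card [X in _ <= 2 * X]big_mkcond big_distrr /=.
apply: leq_sum => w _; rewrite inE; case Qw: (Q w); last first.
  by rewrite big1 // => B _; rewrite andbF.
rewrite andbT; case vw: (e v w); last first.
  rewrite big1 // => B; rewrite inE => /andP[/BB_cyc[/(cycle_spaceP e_sym)[/subsetP BE _] _] _].
  by case: ifP => // /andP[/BE]; rewrite mem_edges // vw.
have := BB_two (x := [set v; w]); rewrite mem_edges // => /(_ vw); apply: leq_trans.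
rewrite -sum1dep_card -big_mkcondr /= !sum1dep_card; apply/subset_leq_card/subsetP => B.
by rewrite !inE andbT => /andP[/andP[-> _] ->].
Qed.

Definition touches (B : {set {set T}}) v := [exists w, [set v; w] \in B].

Definition touching v := [set B in F5 | touches B v].

Lemma touches_deg B v : B \in F5 -> touches B v -> 1 < #|[set w | [set v; w] \in B]|.
Proof.
rewrite inE => /andP[/BB_cyc[/(cycle_spaceP e_sym)[_ /(_ v)] + _] _] /existsP[w vw].
have : 0 < #|[set w | [set v; w] \in B]| by apply/card_gt0P; exists w; rewrite inE.
by case: #|_| => [|[]].
Qed.

(** Each 5-cycle through [v] uses two edges at [v], and each edge is used at most twice. *)
Lemma card_touching v : #|touching v| <= #|nbh v|.
Proof.
rewrite -(leq_pmul2l (m := 2)) //; have := sum_nbh predT v.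
have -> : #|[set w in nbh v | predT w]| = #|nbh v| by apply: eq_card => w; rewrite !inE andbT.
apply: leq_trans; rewrite mulnC -sum_nat_const.
rewrite [X in _ <= X](bigID (fun B => touches B v)) /=.
apply: leq_trans (leq_addr _ _).
under eq_bigl do rewrite inE.
apply: leq_sum => B /andP[BF Bv].
by under eq_finset do rewrite andbT; apply: touches_deg.
Qed.

(** Two 5-cycles through a vertex of degree 2 share both edges there. Their symmetric difference
    then has an even number of edges, at most 6, which [cycle_space_card] forbids unless it is
    empty. *)
Lemma card_touching2 v : #|nbh v| = 2 -> #|touching v| <= 1.
Proof.
move=> v2; rewrite leqNgt; apply/negP => /card_gt1P[B [B' []]].
rewrite !(inE, in_set) => /andP[BF Bv] /andP[BF' Bv'] BB'.
have all (X : {set {set T}}) w : X \in F5 -> touches X v -> w \in nbh v -> [set v; w] \in X.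
  move=> XF Xv; have := touches_deg XF Xv => X2.
  have sub : [set w | [set v; w] \in X] \subset nbh v.
    move: XF; rewrite inE => /andP[/BB_cyc[/(cycle_spaceP e_sym)[/subsetP XE _] _] _].
    by apply/subsetP => u; rewrite !inE => /XE; rewrite mem_edges.
  have /eqP <- : [set w | [set v; w] \in X] == nbh v by rewrite eqEcard sub v2.
  by rewrite inE.
have BF_ : B \in F5 by rewrite inE.
have BF'_ : B' \in F5 by rewrite inE.
move: BF BF'; rewrite ?inE => /andP[Bb /eqP B5] /andP[Bb' /eqP B5'].
have [w1 [w2 [w1v w2v w12]]] : exists w1 w2, [/\ w1 \in nbh v, w2 \in nbh v & w1 != w2].
  by case/card_gt1P: (eq_leq (esym v2)) => w1 [w2 [? ? ?]]; exists w1, w2.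
have I2 : 2 <= #|B :&: B'|.
  apply: (@leq_trans #|[set [set v; w1]; [set v; w2]]|).
    by rewrite cards2; case: eqP => // /edge_inj E; rewrite E eqxx in w12.
  apply/subset_leq_card/subsetP => x; rewrite !inE => /orP[] /eqP ->; by rewrite !all.
have sc := cycle_space_symdiff e_sym (BB_cyc Bb).1 (BB_cyc Bb').1.
have := cycle_space_card e_sym e_irr no_short sc; rewrite symdiff_eq0 => /(_ BB').
have := card_symdiff B B'; rewrite B5 B5' -addnn => h.
by case=> [h6|[h5 _]]; [clear -I2 h h6|clear -I2 h h5]; lia.
Qed.

(* Nine times the usual charges, so that all amounts are integers: a 5-cycle
   has to collect 36, a vertex of degree d owns 9 (5 d - 14), and a big vertex
   sends 42 to each small neighbour. *)
Definition share v :=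
  if #|nbh v| == 2 then (if #|big_nbh v| == 1 then 5 else 36)
  else (if #|big_nbh v| == 1 then 15 else 26).

Definition sent (B : {set {set T}}) v :=
  if big_vertex v then 18 * #|[set w | ([set v; w] \in B) && big_vertex w]|
  else if touches B v then share v else 0.

Lemma sent_small v : v \in S -> ~~ big_vertex v ->
  \sum_(B in F5) sent B v + 127 <= 45 * #|nbh v| + 42 * #|big_nbh v|.
Proof.
move=> vS sm; have -> : \sum_(B in F5) sent B v = #|touching v| * share v.
  rewrite /sent (negbTE sm) -big_mkcondr /= -sum_nat_const.
  by apply: eq_bigl => B; rewrite [RHS]inE.
have := deg_ge2 vS; have := small_has_big vS sm.
have := card_touching v; rewrite /share.
(* The bound is tight for degree 2 with one big neighbour: 5 + 127 = 90 + 42. From degree 3 on, the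
   two cases amount to 85 <= 30 d and, at two or more big neighbours, 43 <= 19 d. *)
case: eqP => [d2|d2] n1 b0 d1; first have := card_touching2 d2.
  by move: d2 n1 b0 d1; move: #|touching v| #|nbh v| #|big_nbh v| => n d b; clear;
    case: eqP; lia.
by move: d2 n1 b0 d1; move: #|touching v| #|nbh v| #|big_nbh v| => n d b; clear;
  case: eqP; nia.
Qed.

(** Each big neighbour costs at most 2 * 18 = 36 and each small one 42, out of 45 per edge. At least
    3 per edge remains, and 3 * 47 exceeds 127. *)
Lemma sent_big v : big_vertex v ->
  \sum_(B in F5) sent B v + 127 + 42 * #|small_nbh v| <= 45 * #|nbh v|.
Proof.
move=> bv; rewrite /sent bv -big_distrr /=.
have d47 : 46 < #|nbh v| := bv.
have := sum_nbh big_vertex v; rewrite -/(big_nbh v).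
move: (\sum_(B in _) _) (card_nbh v) d47 => n.
by move: #|nbh v| #|big_nbh v| #|small_nbh v| => d b c; clear; lia.
Qed.

Lemma sent_cycle B : B \in F5 -> 36 <= \sum_(v in S) sent B v.
Proof.
move=> BF; have := BF; rewrite inE => /andP[/BB_cyc[Bc B0] /eqP B5].
have [|[_ [c]]] := cycle_space_card e_sym e_irr no_short Bc B0; first by rewrite B5.
have er := edge_rel_sub e_sym e_irr Bc.
have ers u v : edge_rel B u v -> edge_rel B v u by rewrite /edge_rel setUC.
case/andP=> cc Uc; case: c cc Uc => [|x0 [|x1 [|x2 [|x3 [|x4 [|? ?]]]]]] //= cc Uc _.
(* Guaranteed amounts according to the neighbours [a] and [b] of [x] on the cycle. If [x], [a] and
   [b] are small, the big neighbour of [x] is off the cycle, so [x] has degree at least 3 and gives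
   15 or more. The total 36 is attained by two adjacent big vertices (18 + 18) and by two
   nonadjacent ones (26 + 5 + 5). *)
have mid a x b : edge_rel B a x -> edge_rel B x b -> a != b ->
  (big_vertex x -> (big_vertex a || big_vertex b -> 18 <= sent B x)) /\
  (~~ big_vertex x -> 5 <= sent B x /\
     (~~ big_vertex a -> ~~ big_vertex b -> 15 <= sent B x) /\
     (big_vertex a -> big_vertex b -> 26 <= sent B x)).
  move=> ax xb ab; split=> [bx bab|sx].
    rewrite /sent bx leq_pmulr //; apply/card_gt0P.
    case/orP: bab => h; [exists a|exists b]; rewrite inE h andbT //.
    exact: ers.
  have xS : x \in S by exact: eS (er _ _ xb).
  have xtouch : touches B x by apply/existsP; exists b.
  rewrite /sent (negbTE sx) xtouch /share.
  have b0 := small_has_big xS sx; have d1 := deg_ge2 xS.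
  split; first by do 2 case: eqP.
  have an : a \in nbh x by rewrite inE er // ers.
  have bn : b \in nbh x by rewrite inE er.
  split=> [sa sb|ba bb].
    case: eqP => d2; last by case: eqP.
    have E : [set a; b] = nbh x.
      apply/eqP; rewrite eqEcard d2 cards2 ab andbT.
      by apply/subsetP => y; rewrite !inE => /orP[] /eqP ->; move: an bn; rewrite !inE.
    move: b0 => /card_gt0P[y]; rewrite inE -E !inE => /andP[/orP[] /eqP ->].
      by rewrite (negbTE sa).
    by rewrite (negbTE sb).
  have b2 : 1 < #|big_nbh x|.
    by apply/card_gt1P; exists a, b; split=> //; rewrite inE ?an ?bn.
  by rewrite [#|big_nbh x| == 1]gtn_eqF //; case: eqP.
have xsS : {subset [:: x0; x1; x2; x3; x4] <= S}.
  have {}cc : cycle e [:: x0; x1; x2; x3; x4] by apply: (sub_cycle er).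
  by move=> y /(next_cycle cc); apply: eS.
have : \sum_(v <- [:: x0; x1; x2; x3; x4]) sent B v <= \sum_(v in S) sent B v.
  rewrite big_uniq //= [X in _ <= X](bigID [in [:: x0; x1; x2; x3; x4]]) /=.
  apply: leq_trans (leq_addr _ _); apply: eq_leq; apply: eq_bigl => y.
  by case h: (y \in [:: _; _; _; _; _]); rewrite ?andbF // andbT xsS.
apply: leq_trans; rewrite !big_cons big_nil.
move: cc; rewrite andbT => /and5P[e01 e12 e23 e34 e40].
move: Uc; rewrite /= !inE !negb_or -!andbA.
case/and5P => n01 n02 n03 n04 /and5P[n12 n13 n14 n23 /and3P[n24 n34 _]].
have [] := mid _ _ _ e40 e01 _; first by rewrite eq_sym.
have [] := mid _ _ _ e01 e12 n02.
have [] := mid _ _ _ e12 e23 n13.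
have [] := mid _ _ _ e23 e34 n24.
have [] := mid _ _ _ e34 e40 _; first by rewrite eq_sym.
move: (sent B x0) (sent B x1) (sent B x2) (sent B x3) (sent B x4) => s0 s1 s2 s3 s4.
clear; by case: (big_vertex x0); case: (big_vertex x1); case: (big_vertex x2);
  case: (big_vertex x3); case: (big_vertex x4) => /=; lia.
Qed.

Lemma handshake : \sum_(v in S) #|nbh v| = 2 * #|edges e|.
Proof.
transitivity (\sum_(x in edges e) #|x|); last first.
  by rewrite mulnC -sum_nat_const; apply: eq_bigr => x /(edge_card e_irr).
transitivity (\sum_(v in S) #|[set x in edges e | v \in x]|).
  apply: eq_bigr => v _; rewrite (card_incident e_sym) //.
  by apply: eq_card => w; rewrite !inE mem_edges.
under eq_bigr do rewrite -sum1dep_card big_mkcondr /=.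
rewrite exchange_big /=; apply: eq_bigr => x xE.
rewrite -big_mkcondr /= sum1dep_card; apply: eq_card => v; rewrite inE.
by case vx: (v \in x); rewrite ?andbF // andbT; have [u /eS ->] := edge_at e_sym vx xE.
Qed.

Lemma sum_small_big : \sum_(v in S | ~~ big_vertex v) #|big_nbh v| =
  \sum_(v in S | big_vertex v) #|small_nbh v|.
Proof.
rewrite big_mkcond [RHS]big_mkcond /=.
transitivity (\sum_v \sum_w [&& e v w, ~~ big_vertex v & big_vertex w]).
  apply: eq_bigr => v _; rewrite -sum1dep_card [in LHS]big_mkcond /=.
  case: ifP => [/andP[_ ->]|h].
    by apply: eq_bigr => w _; rewrite inE; case: (e v w).
  rewrite big1 // => w _; case vw: (e v w) => //=.
  by move: h; rewrite (eS vw) /= => ->.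
rewrite exchange_big; apply: eq_bigr => v _ /=; rewrite -sum1dep_card [in RHS]big_mkcond /=.
case: ifP => [/andP[_ ->]|h].
  by apply: eq_bigr => w _; rewrite inE e_sym andbT; case: (e v w).
rewrite big1 // => w _; rewrite e_sym; case vw: (e v w) => //=.
by move: h; rewrite (eS vw) /= => ->; rewrite andbF.
Qed.

Lemma discharging : #|edges e| <= #|BB| + #|S| -> S = set0.
Proof.
move=> euler; apply/eqP; rewrite -cards_eq0.
have total : \sum_(v in S) \sum_(B in F5) sent B v + 127 * #|S| +
     42 * \sum_(v in S | big_vertex v) #|small_nbh v| <=
   45 * \sum_(v in S) #|nbh v| + 42 * \sum_(v in S | ~~ big_vertex v) #|big_nbh v|.
  rewrite mulnC -sum_nat_const -!big_split /= !big_distrr /=.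
  rewrite [X in _ + X <= _]big_mkcondr [X in _ <= _ + X]big_mkcondr -!big_split /=.
  apply: leq_sum => v vS; case: ifP => bv /=.
    by rewrite addn0; apply: sent_big.
  by rewrite addn0; apply: sent_small => //; rewrite bv.
have faces : 36 * #|F5| <= \sum_(v in S) \sum_(B in F5) sent B v.
  by rewrite exchange_big mulnC -sum_nat_const; apply: leq_sum => B; apply: sent_cycle.
(* A face that is not a 5-cycle has at least 7 edges, and the face sizes add up to at most twice the
   number of edges. *)
have count : 7 * #|BB| <= 2 * #|edges e| + 2 * #|F5|.
  apply: (@leq_trans (\sum_(B in BB) #|B| + 2 * #|F5|)).
    rewrite mulnC -sum_nat_const [2 * _]mulnC -sum_nat_const.
    rewrite [X in _ + X](eq_bigl (fun B => (B \in BB) && (#|B| == 5))); last first.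
      by move=> B; rewrite inE.
    rewrite [X in _ + X]big_mkcondr -big_split /=; apply: leq_sum => B /BB_cyc[Bc B0].
    by have [h|[-> //]] := cycle_space_card e_sym e_irr no_short Bc B0;
      apply: leq_trans h (leq_addr _ _).
  rewrite leq_add2r mulnC -sum_nat_const.
  under eq_bigr do rewrite -sum1_card big_mkcond.
  rewrite exchange_big [X in X <= _](bigID [in edges e]) /= [X in _ + X]big1 ?addn0.
    apply: leq_sum => x xE; apply: leq_trans (BB_two xE).
    by rewrite -big_mkcondr /= sum1dep_card.
  move=> x xE; rewrite big1 // => B /BB_cyc[/(cycle_spaceP e_sym)[/subsetP BE _] _].
  by case: ifP => // /BE; rewrite (negbTE xE).
rewrite handshake sum_small_big in total.
(* [count] and [euler] give 90 |E| <= 36 |F5| + 126 |S|, whereas [total] and [faces] give 36 |F5| +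
   127 |S| <= 90 |E|. *)
move: total faces count euler; clear; lia.
Qed.

End Discharging.

(** * Reducible vertices and induction on induced subgraphs *)

Section Reducible.
Variables (T : finType) (e : rel T).
Hypotheses (e_sym : symmetric e) (e_irr : irreflexive e).
Hypothesis no_triangle : forall a b c, e a b -> e b c -> e c a -> False.

(** A (0,45)-colouring of the subgraph induced by [S], with independent class [A]. *)
Definition good_part (S A : {set T}) := [/\ A \subset S,
  {in A &, forall u v, ~~ e u v} &
  {in S :\: A, forall v, #|[set w in S :\: A | e v w]| <= 45}].

(** If [v] has no neighbour in [A], it joins [A]. Otherwise it joins the other class, where it has
    at most 45 neighbours, and its saturated neighbours move to [A]. These have no neighbour in [A],
    and they are pairwise nonadjacent because they share the neighbour [v] and there is no
    triangle. *)
Lemma extend_good_part (S A : {set T}) v : v \in S -> good_part (S :\ v) A ->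
  #|[set w in S | e v w]| <= 46 ->
  (forall a u, a \in A -> e v a -> u \in S -> e v u -> u \notin A ->
     #|[set w in S | e u w]| <= 46) ->
  exists A', good_part S A'.
Proof.
move=> vS [AS Aind Adeg] dv du.
have AsubS : A \subset S by apply: subset_trans AS _; apply: subsetDl.
have vA : v \notin A by apply/negP => /(subsetP AS); rewrite !inE eqxx.
have [a /andP[aA va]|noA] := pickP [pred a in A | e v a]; last first.
  exists (v |: A); split.
  - by apply/subsetP => x /setU1P[->//|/(subsetP AsubS)].
  - move=> x y /setU1P[->|xA] /setU1P[->|yA]; rewrite ?e_irr //.
    + by have := noA y; rewrite /= yA /= => ->.
    + by have := noA x; rewrite /= xA /= e_sym => ->.
    + exact: Aind.
  have -> : S :\: (v |: A) = (S :\ v) :\: A.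
    by apply/setP => x; rewrite !inE negb_or; case: (x == v); case: (x \in A).
  exact: Adeg.
pose K := (S :\ v) :\: A.
(* The neighbours of [v] with 45 neighbours in their class already, for which [v] would be one too
   many. *)
pose sat := [set u in K | e v u && (44 < #|[set w in K | e u w]|)].
have satA u x : u \in sat -> x \in A -> ~~ e u x.
  rewrite inE => /andP[uK /andP[vu su]] xA; apply/negP => ux.
  have [uS uA] : u \in S /\ u \notin A by move: uK; rewrite !inE => /andP[-> /andP[_ ->]].
  have := du a u aA va uS vu uA; rewrite leqNgt => /negP; apply.
  (* A saturated [u] with a neighbour [x] in [A] would have degree at least 47: 45 neighbours in
     [K], then [v] and [x]. *)
  have sub : v |: (x |: [set w in K | e u w]) \subset [set w in S | e u w].
    apply/subsetP => y /setU1P[->|/setU1P[->|]]; rewrite !inE.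
    - by rewrite vS e_sym.
    - by rewrite (subsetP AsubS).
    - by case/andP=> /and3P[_ _ ->].
  apply: leq_trans (subset_leq_card sub); rewrite !cardsU1 !inE xA eqxx /= ?andbF.
  have -> : (v == x) = false by apply: contraNF vA => /eqP ->.
  by rewrite /= !add1n.
exists (A :|: sat); split.
- apply/subsetP => x /setUP[/(subsetP AsubS)//|]; rewrite !inE.
  by case/andP=> /and3P[_ _ ->].
- move=> x y /setUP[xA|xs] /setUP[yA|ys]; first exact: Aind.
  + by rewrite e_sym satA.
  + exact: satA.
  apply/negP => xy; move: xs ys; rewrite !inE => /andP[_ /andP[vx _]] /andP[_ /andP[vy _]].
  by apply: (no_triangle vx xy); rewrite e_sym.
move=> x; rewrite in_setD in_setU negb_or => /andP[/andP[xA xs] xS].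
have [->|xv] := eqVneq x v.
  rewrite -ltnS; apply: leq_trans dv; apply/proper_card/properP; split.
    by apply/subsetP => y; rewrite !inE => /andP[/andP[_ ->]].
  by exists a; rewrite !inE ?va ?aA ?(subsetP AsubS).
have xK : x \in K by rewrite !inE xA xv xS.
have := Adeg x xK; rewrite -/K => Kx.
have sub : [set w in S :\: (A :|: sat) | e x w] \subset
    (if e v x then v |: [set w in K | e x w] else [set w in K | e x w]).
  apply/subsetP => y; rewrite !inE !negb_or => /andP[/andP[/andP[yA _] yS] xy].
  have [yv|yv] := eqVneq y v; first by move: xy; rewrite yv e_sym => ->; rewrite !inE eqxx.
  by case: ifP => _; rewrite !inE yA yS yv xy ?orbT.
apply: leq_trans (subset_leq_card sub) _; case: ifP => // vx.
apply: leq_trans (leq_card_setU _ _) _; rewrite cards1 add1n.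
by move: xs; rewrite inE xK vx /= -leqNgt.
Qed.

Hypothesis no_short : forall c, ucycle e c -> size c != 3 /\ size c != 4 /\ size c != 6.
(** The form in which planarity enters; it is asked of all subgraphs because the induction runs over
    induced ones. *)
Hypothesis sub_faces : forall (e' : rel T) (S : {set T}),
  symmetric e' -> subrel e' e -> (forall u v, e' u v -> u \in S) ->
  exists BB : {set {set {set T}}},
  [/\ {in BB, forall B, B \in cycle_space e' /\ B != set0},
      forall x, x \in edges e' -> #|[set B in BB | x \in B]| <= 2 &
      #|edges e'| <= #|BB| + #|S|].

Lemma exists_good_part (S : {set T}) : exists A, good_part S A.
Proof.
elim/(well_founded_induction (Wf_nat.well_founded_ltof _ (fun S : {set T} => #|S|))): S => S IH.
have {}IH v : v \in S -> exists A, good_part (S :\ v) A.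
  by move=> vS; apply: IH; apply/ltP; rewrite [X in _ < X](cardsD1 v) vS.
have [S0|/set0Pn[s sS]] := eqVneq S set0.
  by exists set0; split=> [|x y|v]; rewrite ?S0 ?sub0set // !inE.
pose eS u v := [&& u \in S, v \in S & e u v].
have eS_sub : subrel eS e by move=> u v /and3P[].
have eS_sym : symmetric eS by move=> u v; rewrite /eS e_sym andbCA.
have eS_irr : irreflexive eS by move=> u; rewrite /eS e_irr !andbF.
have eS_S u v : eS u v -> u \in S by case/andP.
have eS_short c : ucycle eS c -> size c != 3 /\ size c != 4 /\ size c != 6.
  case/andP=> cc Uc; apply: no_short; apply/andP; split=> //.
  exact: (sub_cycle eS_sub) cc.
have nbhE u : u \in S -> nbh eS u = [set w in S | e u w].
  by move=> uS; apply/setP => w; rewrite !inE /eS uS.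
have [BB [BBc BB2 euler]] := sub_faces eS_sym eS_sub eS_S.
(* If every vertex satisfies both degree conditions, discharging forces [S] to be empty; otherwise
   some [v] is reducible. *)
case: (boolP [forall v in S, (1 < #|nbh eS v|) &&
    (~~ big_vertex eS v ==> (0 < #|big_nbh eS v|))]) => [/forall_inP h|].
  have := @discharging T eS S eS_sym eS_irr eS_S eS_short _ _ BB BBc BB2 euler.
  move=> dis; rewrite dis ?inE // in sS => x xS; have /andP[? /implyP] := h x xS; by auto.
case/forall_inPn => v vS; have [A gA] := IH v vS.
have AS : A \subset S by case: gA => AS _ _; apply: subset_trans AS (subsetDl _ _).
have ext : #|nbh eS v| <= 46 -> (forall a u, a \in nbh eS v -> u \in nbh eS v ->
    a != u -> #|nbh eS u| <= 46) -> exists A, good_part S A.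
  rewrite nbhE // => dv du; apply: extend_good_part gA dv _ => // a u aA va uS vu uA.
  have aS := subsetP AS a aA.
  rewrite -nbhE //; apply: (du a); rewrite ?inE ?aS ?uS //.
  by apply: contraNneq uA => <-.
(* If [v] has degree at most 1, it has no two distinct neighbours and the condition on [u] is void;
   otherwise [v] is small and so are all its neighbours. *)
rewrite negb_and -leqNgt negb_imply => /orP[d1|/andP[nb]].
  apply: ext => [|a u av uv au]; first by apply: leq_trans d1 _.
  by have /card_le1_eqP h := d1; rewrite (h _ _ av uv) eqxx in au.
rewrite lt0n negbK cards_eq0 => /eqP nobig; apply: ext => [|a u _ uv _].
  by rewrite leqNgt.
rewrite leqNgt; apply/negP => bu; have /setP/(_ u) := nobig.
by rewrite in_set in_set0 uv => /negP[].
Qed.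

End Reducible.

(** * Polygonal drawings *)

From mathcomp Require Import all_order all_algebra ring lra.
Import Order.TTheory GRing.Theory Num.Theory.

(** * Vertical and radial order of segments *)

Section Segments.
Local Open Scope ring_scope.
Variable R : realFieldType.
Implicit Types a b p q v y : R * R.

(** Twice the signed area of the triangle [abp]. When [a.1 < b.1], it is positive exactly for [p]
    above the line [ab]. *)
Definition orient a b p := (b.1 - a.1) * (p.2 - a.2) - (b.2 - a.2) * (p.1 - a.1).

Definition segdisj a b p q := forall s t : R, 0 <= s <= 1 -> 0 <= t <= 1 ->
  a.1 + s * (b.1 - a.1) = p.1 + t * (q.1 - p.1) ->
  a.2 + s * (b.2 - a.2) = p.2 + t * (q.2 - p.2) -> False.

(* Does the upward vertical ray from [p] cross the segment [ab]?  The segment is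
   half-open in the first coordinate. *)
Definition crosses a b p :=
  ((a.1 <= p.1) (+) (b.1 <= p.1)) && ((b.1 - a.1) * orient a b p < 0).

(* Does the downward vertical ray from [a] cross the segment [pq]?  The half-open
   convention is opposite to that of [crosses], as if the segment were shifted
   infinitesimally to the right. *)
Definition above p q a :=
  ((p.1 < a.1) (+) (q.1 < a.1)) && (0 < (q.1 - p.1) * orient p q a).

Lemma orientC a b p : orient b a p = - orient a b p.
Proof. rewrite /orient; ring. Qed.

Lemma crossesC a b p : crosses b a p = crosses a b p.
Proof.
rewrite /crosses addbC orientC; congr (_ && _).
by rewrite -(opprB b.1) mulrNN.
Qed.

Lemma aboveC p q a : above q p a = above p q a.
Proof. by rewrite /above addbC orientC -(opprB q.1) mulrNN. Qed.

Lemma segdisjC a b p q : segdisj a b p q -> segdisj p q a b.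
Proof. by move=> h s t hs ht E1 E2; apply: (h t s). Qed.

Lemma segdisj_revl a b p q : segdisj a b p q -> segdisj b a p q.
Proof.
move=> h s t hs ht E1 E2; apply: (h (1 - s) t) => //; first by lra.
  rewrite -E1; ring.
rewrite -E2; ring.
Qed.

Lemma segdisj_revr a b p q : segdisj a b p q -> segdisj a b q p.
Proof. by move=> /segdisjC/segdisj_revl/segdisjC. Qed.

Definition on_seg (p q : R * R) (t : R) : R * R :=
  (p.1 + t * (q.1 - p.1), p.2 + t * (q.2 - p.2)).

Lemma segdisj_subr a b p q t : 0 <= t <= 1 -> segdisj a b p q ->
  segdisj a b p (on_seg p q t).
Proof.
move=> ht h s u hs hu /= E1 E2; apply: (h s (u * t)) => //.
- have /andP[h1 h2] := ht; have /andP[h3 h4] := hu.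
  by rewrite mulr_ge0 //= mulr_ile1.
- rewrite E1; ring.
- rewrite E2; ring.
Qed.

(** [orient a b] is affine along [pq] and changes sign, so it vanishes at some point of [pq]. That
    point is on the line [ab] and in the vertical strip over [ab], hence on the segment. *)
Lemma meet_of_sides a b p q : a.1 < b.1 -> a.1 <= p.1 <= b.1 -> a.1 <= q.1 <= b.1 ->
  orient a b p <= 0 <= orient a b q -> ~ segdisj a b p q.
Proof.
move=> ab hp hq /andP[op oq] h.
have [t ht Et] : exists2 t, 0 <= t <= 1 & orient a b (on_seg p q t) = 0.
  have E t : orient a b (on_seg p q t) =
      orient a b p + t * (orient a b q - orient a b p) by rewrite /orient /=; ring.
  have [D|D] := eqVneq (orient a b q - orient a b p) 0.
    exists 0; rewrite ?lexx ?ler01 // E mul0r addr0.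
    by apply/eqP; rewrite eq_le op -[orient a b p](subrK (orient a b q)); lra.
  have Dp : 0 < orient a b q - orient a b p by rewrite lt_neqAle eq_sym D subr_ge0 (le_trans op).
  exists (- orient a b p / (orient a b q - orient a b p)); last by rewrite E; field.
  by apply/andP; split; [apply: divr_ge0; lra|rewrite ler_pdivrMr //; lra].
set z := on_seg p q t in Et.
have hz : a.1 <= z.1 <= b.1.
  by rewrite /z /=; move: hp hq ht; clear; move: p.1 q.1 a.1 b.1 => p1 q1 a1 b1; nra.
have ab0 : b.1 - a.1 != 0 by rewrite subr_eq0 gt_eqF.
have abp : 0 < b.1 - a.1 by rewrite subr_gt0.
apply: (h ((z.1 - a.1) / (b.1 - a.1)) t) => //.
- by apply/andP; split; [apply: divr_ge0; lra|rewrite ler_pdivrMr //; lra].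
- by rewrite divfK // -/z /z /=; ring.
- have : z.2 = a.2 + (b.2 - a.2) * (z.1 - a.1) / (b.1 - a.1).
    move: Et; rewrite /orient; move: z.1 z.2 => z1 z2 /eqP; rewrite subr_eq0 => /eqP <-.
    by rewrite [_ * _ / _]mulrC mulKf // addrC subrK.
  by move=> E; rewrite -[RHS]/(z.2) E; move: (z.1) => z1; field.
Qed.

Lemma same_side a b p q : a.1 < b.1 -> a.1 <= p.1 <= b.1 -> a.1 <= q.1 <= b.1 ->
  segdisj a b p q -> (orient a b p < 0) = (orient a b q < 0) /\
  (0 < orient a b p) = (0 < orient a b q).
Proof.
move=> ab hp hq h; have h' := segdisj_revr h.
have := @meet_of_sides a b p q ab hp hq; have := @meet_of_sides a b q p ab hq hp.
case: (ltrgtP (orient a b p) 0) => op; case: (ltrgtP (orient a b q) 0) => oq //=;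
  rewrite ?ltxx //; move=> h1 h2; exfalso.
all: try (by apply: h1 => //; rewrite ?op ?oq ?lexx ?ltW).
all: try (by apply: h2 => //; rewrite ?op ?oq ?lexx ?ltW).
Qed.

(** Cutting [pq] at the abscissa of [b] brings both ends into the strip of [ab], where [same_side]
    applies; at the cut, the vertical order of the segments can be read from either one. *)
Lemma overlap_left a b p q : p.1 < q.1 -> a.1 <= p.1 < b.1 -> b.1 <= q.1 ->
  segdisj a b p q -> (orient a b p < 0) = (0 < orient p q b).
Proof.
move=> pq /andP[ap pb] bq h.
have qp0 : q.1 - p.1 != 0 by rewrite subr_eq0 gt_eqF.
pose t := (b.1 - p.1) / (q.1 - p.1).
have ht : 0 <= t <= 1.
  by apply/andP; split; [apply: divr_ge0; lra|rewrite ler_pdivrMr; lra].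
have z1 : (on_seg p q t).1 = b.1 by rewrite /= /t divfK //; ring.
have ab : a.1 < b.1 by lra.
have hp : a.1 <= p.1 <= b.1 by rewrite ap ltW.
have hz : a.1 <= (on_seg p q t).1 <= b.1 by rewrite z1 lexx ltW.
have [-> _] := same_side ab hp hz (segdisj_subr ht h).
have -> : orient a b (on_seg p q t) = - ((b.1 - a.1) / (q.1 - p.1) * orient p q b).
  by rewrite /orient z1 /= /t; field.
by rewrite oppr_lt0 pmulr_rgt0 // divr_gt0 // subr_gt0.
Qed.

Lemma overlap_right a b p q : p.1 < q.1 -> p.1 <= a.1 -> a.1 <= q.1 < b.1 ->
  segdisj a b p q -> (orient a b q < 0) = (0 < orient p q a).
Proof.
move=> pq pa /andP[aq qb] h.
have qp0 : q.1 - p.1 != 0 by rewrite subr_eq0 gt_eqF.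
pose t := (q.1 - a.1) / (q.1 - p.1).
have ht : 0 <= t <= 1.
  by apply/andP; split; [apply: divr_ge0; lra|rewrite ler_pdivrMr; lra].
have z1 : (on_seg q p t).1 = a.1.
  by rewrite /= -(opprB q.1 p.1) mulrN /t divfK //; ring.
have ab : a.1 < b.1 by lra.
have hq : a.1 <= q.1 <= b.1 by rewrite aq ltW.
have hz : a.1 <= (on_seg q p t).1 <= b.1 by rewrite z1 lexx ltW.
have [-> _] := same_side ab hq hz (segdisj_subr ht (segdisj_revr h)).
have -> : orient a b (on_seg q p t) = - ((b.1 - a.1) / (q.1 - p.1) * orient p q a).
  by rewrite /orient z1 /= /t; field.
by rewrite oppr_lt0 pmulr_rgt0 // divr_gt0 // subr_gt0.
Qed.

(** Disjoint segments keep their vertical order over the common part of their projections. Each end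
    of that common interval comes from an endpoint of one of the segments and yields one nonzero
    term if [ab] is above [pq], or if it is below, depending on the kind of endpoint. *)
Lemma cross_switch a b p q : segdisj a b p q ->
  crosses a b p (+) crosses a b q = above p q a (+) above p q b.
Proof.
wlog ab : a b / a.1 <= b.1.
  move=> H; case: (leP a.1 b.1) => [|/ltW] ab h; first exact: H.
  by rewrite -(crossesC a) -(crossesC a b q) (H b a) //; [rewrite addbC|exact: segdisj_revl].
wlog pq : p q / p.1 <= q.1.
  move=> H; case: (leP p.1 q.1) => [|/ltW] pq h; first exact: H.
  by rewrite -(aboveC p) -(aboveC p q b) -(H q p) //; [rewrite addbC|exact: segdisj_revr].
move=> h.
have crE z : a.1 < b.1 -> ((b.1 - a.1) * orient a b z < 0) = (orient a b z < 0).
  by move=> lt; rewrite pmulr_rlt0 ?subr_gt0.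
have abE z : p.1 < q.1 -> (0 < (q.1 - p.1) * orient p q z) = (0 < orient p q z).
  by move=> lt; rewrite pmulr_rgt0 ?subr_gt0.
rewrite /crosses /above.
(* The opposite half-open conventions of [crosses] and [above] let the same four comparisons decide
   all strip tests. Four cases remain: overlap on either side and the two inclusions. *)
case: (leP a.1 p.1) => ap; case: (leP b.1 p.1) => bp;
case: (leP a.1 q.1) => aq; case: (leP b.1 q.1) => bq;
rewrite /= ?addbF //; try (exfalso; move: ap bp aq bq ab pq; clear; lra).
- have lt : a.1 < b.1 by lra.
  have lt' : p.1 < q.1 by lra.
  by rewrite crE // abE //; apply: overlap_left => //; rewrite ap bp.
- have lt : a.1 < b.1 by lra.
  have hp : a.1 <= p.1 <= b.1 by rewrite ap ltW.
  have hq : a.1 <= q.1 <= b.1 by rewrite aq ltW.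
  by rewrite !crE //; have [-> _] := same_side lt hp hq h; rewrite addbb.
- have lt : p.1 < q.1 by lra.
  have ha : p.1 <= a.1 <= q.1 by rewrite aq ltW.
  have hb : p.1 <= b.1 <= q.1 by rewrite bq ltW.
  by rewrite !abE //; have [_ ->] := same_side lt ha hb (segdisjC h); rewrite addbb.
- have lt : a.1 < b.1 by lra.
  have lt' : p.1 < q.1 by lra.
  by rewrite crE // abE //; apply: overlap_right => //; [exact: ltW|exact/andP].
Qed.

(* Directions at [v] are split into the half-planes [dx > 0 \/ dx = 0 > dy] and
   its opposite; within each, [higher] orders them by slope, the vertical one
   being extremal. *)
Definition rightward v b := (v.1 < b.1) || (v.1 == b.1) && (b.2 < v.2).

Definition higher v b y :=
  (rightward v b == rightward v y) &&
  (if rightward v y then 0 < orient v y b else orient v y b < 0).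

(** This replaces [cross_switch] for two segments issuing from [v]: the defect caused by the common
    end is their radial order. *)
Lemma cross_radial v y b : crosses v b y (+) above v y b = higher v b y.
Proof.
rewrite /crosses /above /higher /rightward.
have oE : orient v b y = - orient v y b by rewrite /orient; ring.
rewrite oE mulrN oppr_lt0.
have [hb|hb|hb] := ltrgtP v.1 b.1; have [hy|hy|hy] := ltrgtP v.1 y.1;
  rewrite /= ?hb ?hy ?subrr ?mul0r ?ltxx ?andbF //=.
- move: (orient v y b) => o.
  have {}hb : 0 < b.1 - v.1 by rewrite subr_gt0.
  have {}hy : 0 < y.1 - v.1 by rewrite subr_gt0.
  rewrite !pmulr_rgt0 // -ltNge.
  by case: (y.1 < b.1); case: (0 < o).
- by rewrite leNgt (lt_trans hy hb).
- have -> : orient v y b = (v.2 - y.2) * (b.1 - v.1) by rewrite /orient -hy; ring.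
  rewrite -hy -ltNge hb addbF /= pmulr_rgt0 ?subr_gt0 // pmulr_lgt0 ?subr_gt0 //.
  by case: (y.2 < v.2).
- by rewrite [y.1 < b.1]ltNge (ltW (lt_trans hb hy)).
- move: (orient v y b) => o.
  have {}hb : b.1 - v.1 < 0 by rewrite subr_lt0.
  have {}hy : y.1 - v.1 < 0 by rewrite subr_lt0.
  rewrite !nmulr_rgt0 // [y.1 < b.1]ltNge.
  by case: (b.1 <= y.1); rewrite ?addbF.
- have -> : orient v y b = (v.2 - y.2) * (b.1 - v.1) by rewrite /orient -hy; ring.
  rewrite -hy (ltW hb) /= nmulr_llt0 ?subr_lt0 // subr_gt0.
  by case: (y.2 < v.2).
- have -> : orient v y b = (b.2 - v.2) * (y.1 - v.1) by rewrite /orient -hb; ring.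
  rewrite -hb [y.1 < v.1]ltNge (ltW hy) /= pmulr_lgt0 ?subr_gt0 //.
  by case: (ltrgtP b.2 v.2).
- have -> : orient v y b = (b.2 - v.2) * (y.1 - v.1) by rewrite /orient -hb; ring.
  rewrite -hb hy /= nmulr_rgt0 ?subr_lt0 // nmulr_llt0 ?subr_lt0 // subr_gt0.
  by case: (ltrgtP b.2 v.2).
- have -> : orient v y b = 0 by rewrite /orient -hy -hb; ring.
  by rewrite -hb -hy !ltxx if_same andbF.
Qed.

Lemma higher_irr v b : higher v b b = false.
Proof.
rewrite /higher; have -> : orient v b b = 0 by rewrite /orient; ring.
by rewrite ltxx if_same andbF.
Qed.

Lemma higher_trans v b a c : higher v a b -> higher v b c -> higher v a c.
Proof.
(* Transitivity for difference vectors in the right half-plane, by the three-term identity between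
   their determinants. The left half-plane follows by negating the vectors. *)
have K (x1 x2 y1 y2 z1 z2 : R) : 0 < y1 \/ y1 = 0 /\ y2 <= 0 ->
    0 < z1 \/ z1 = 0 /\ z2 <= 0 -> 0 < x1 \/ x1 = 0 /\ x2 <= 0 ->
    0 < y1 * x2 - y2 * x1 -> 0 < z1 * y2 - z2 * y1 -> 0 < z1 * x2 - z2 * x1.
  move=> [hy|[-> hy]] hz hx; last by case: hz => [hz|[-> hz]]; rewrite ?mulr0 ?mul0r; nra.
  move=> oyx ozy; rewrite -(pmulr_lgt0 _ hy).
  have -> : (z1 * x2 - z2 * x1) * y1 =
    (y1 * x2 - y2 * x1) * z1 + (z1 * y2 - z2 * y1) * x1 by ring.
  have z0 : 0 <= z1 by case: hz => [/ltW|[->]].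
  case: hx => [hx|[x0 hx]]; first by rewrite ltr_wpDl ?mulr_gt0 // mulr_ge0 // ltW.
  by exfalso; move: oyx; rewrite x0 mulr0 subr0; nra.
have rP z : rightward v z -> 0 < z.1 - v.1 \/ z.1 - v.1 = 0 /\ z.2 - v.2 <= 0.
  case/orP=> [h|/andP[/eqP <- h]]; first by left; rewrite subr_gt0.
  by right; rewrite subrr subr_le0 ltW.
have lP z : ~~ rightward v z -> 0 < v.1 - z.1 \/ v.1 - z.1 = 0 /\ v.2 - z.2 <= 0.
  rewrite negb_or negb_and -!leNgt => /andP[].
  rewrite le_eqVlt => /orP[/eqP -> |h _]; last by left; rewrite subr_gt0.
  by rewrite eqxx /= => h; right; rewrite subrr subr_le0.
rewrite /higher => /andP[/eqP Ea h1] /andP[/eqP Eb h2]; rewrite Ea Eb eqxx /=; move: h1 h2.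
rewrite Eb; case: ifP => rc h1 h2; rewrite /orient.
  apply: K h1 h2; apply: rP; rewrite ?Ea ?Eb ?rc //.
have := K (v.1 - c.1) (v.2 - c.2) (v.1 - b.1) (v.2 - b.2) (v.1 - a.1) (v.2 - a.2).
move=> /(_ (lP _ _) (lP _ _) (lP _ _)); rewrite ?Ea ?Eb ?rc.
move: h1 h2; rewrite /orient => h1 h2 /(_ isT isT isT) K'.
suff: 0 < (v.1 - a.1) * (v.2 - c.2) - (v.2 - a.2) * (v.1 - c.1) by clear; lra.
by apply: K'; [move: h2|move: h1]; clear; lra.
Qed.

Definition pos_parallel v b y := exists2 k : R, 0 < k &
  b.1 - v.1 = k * (y.1 - v.1) /\ b.2 - v.2 = k * (y.2 - v.2).

(** A zero determinant within one half-plane would make the two directions positively parallel; [k]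
    is the ratio of two nonzero coordinates. *)
Lemma higher_total v b y : b <> v -> y <> v -> ~ pos_parallel v b y ->
  rightward v b = rightward v y -> higher v b y || higher v y b.
Proof.
have D (b' y' : R) : b' != 0 -> y' != 0 -> (b' < 0) = (y' < 0) -> 0 < b' / y'.
  move=> b0 y0 E; have [hb|hb] := ltP b' 0.
    have : 0 < (- b') / (- y') by rewrite divr_gt0 ?oppr_gt0 -?E.
    by rewrite invrN mulrNN.
  rewrite divr_gt0 // lt_def ?b0 ?y0 //= leNgt -E; exact/negbT/le_gtF.
move=> bv yv npar E; rewrite /higher E eqxx /=.
have -> : orient v b y = - orient v y b by rewrite /orient; ring.
rewrite oppr_gt0 oppr_lt0.
have [o|o|o] := ltrgtP (orient v y b) 0; rewrite ?if_same ?orbT ?orTb //;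
  try by case: (rightward v y).
exfalso; apply: npar; move: o E bv yv; rewrite /orient /rightward /pos_parallel.
case: v b y => v1 v2 [b1 b2] [y1 y2] /= /eqP; rewrite subr_eq0 => /eqP o.
rewrite -![v1 < _]subr_gt0 -![v1 == _]subr_eq0 -![_ < v2]subr_lt0.
rewrite -!(opprB _ v1) !oppr_eq0 => E bv yv.
have {}bv : ~ (b1 - v1 = 0 /\ b2 - v2 = 0).
  by case=> /eqP + /eqP; rewrite !subr_eq0 => /eqP ? /eqP ?; apply: bv; congr pair.
have {}yv : ~ (y1 - v1 = 0 /\ y2 - v2 = 0).
  by case=> /eqP + /eqP; rewrite !subr_eq0 => /eqP ? /eqP ?; apply: yv; congr pair.
move: o E bv yv; move: (b1 - v1) (b2 - v2) (y1 - v1) (y2 - v2) => {}b1 {}b2 {}y1 {}y2.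
move=> o E bv yv; have [y10|y10] := eqVneq y1 0.
  have y20 : y2 != 0 by apply/eqP => y20; apply: yv.
  have b10 : b1 = 0 by apply/eqP; move/esym/eqP: o; rewrite y10 mul0r mulf_eq0 (negbTE y20).
  have b20 : b2 != 0 by apply/eqP => b20; apply: bv.
  exists (b2 / y2); last by rewrite y10 b10 mulr0 divfK.
  move: E; rewrite y10 b10 ltxx eqxx /=.
  exact: D.
have b10 : b1 != 0.
  apply/eqP => b10; apply: bv; split=> //; move: o; rewrite b10 mulr0 => /eqP.
  by rewrite mulf_eq0 (negbTE y10) => /eqP.
exists (b1 / y1); last first.
  by rewrite divfK //; split=> //; rewrite mulrAC -[b1 * y2]mulrC -o mulrC mulKf.
move: E; rewrite (negbTE y10) (negbTE b10) /= !orbF.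
have N (z : R) : z != 0 -> (z < 0) = ~~ (0 < z).
  by move=> z0; rewrite -leNgt lt_neqAle z0.
by move=> E; apply: D => //; rewrite !N // E.
Qed.

Lemma crosses_start v b : crosses v b v = false.
Proof.
by rewrite /crosses (_ : orient v b v = 0) ?mulr0 ?ltxx ?andbF // /orient; ring.
Qed.

Lemma above_start v y : above v y v = false.
Proof.
by rewrite /above (_ : orient v y v = 0) ?mulr0 ?ltxx ?andbF // /orient; ring.
Qed.

End Segments.

(** * Winding parities in a polygonal drawing *)

Section Polygonal.
Local Open Scope ring_scope.
Variables (R : realFieldType) (T : finType).

Definition segs (l : seq (R * R)) := zip l (behead l).

Definition cross_path l p := \big[addb/false]_(z <- segs l) crosses z.1 z.2 p.

Lemma cross_path_switch p q a l :
  (forall z, z \in segs (a :: l) -> segdisj z.1 z.2 p q) ->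
  cross_path (a :: l) p (+) cross_path (a :: l) q = above p q a (+) above p q (last a l).
Proof.
elim: l a => [|b l IH] a h; first by rewrite /cross_path !big_nil /= !addbb.
rewrite /cross_path /segs /= !big_cons /= -!/(segs (b :: l)) -!/(cross_path (b :: l) _).
rewrite addbACA cross_switch; last by apply: (h (a, b)); rewrite inE eqxx.
rewrite IH; last by move=> z zl; apply: h; rewrite inE zl orbT.
by rewrite addbA addbK.
Qed.

Variables (pos : T -> R * R) (Q : T -> T -> seq (R * R)).

Definition exit_pt u v := head (pos u) (Q u v).

(* The edge [uv] is drawn as the polygon [pos u :: Q u v ++ [:: pos v]].  Only
   its first and last segments are allowed near vertices; different edges do not
   meet, but an edge may cross itself. *)
Record polygonal_drawing (e : rel T) : Prop := PolygonalDrawing {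
  pg_nonempty : forall u v, e u v -> Q u v != [::];
  pg_rev : forall u v, e u v -> Q v u = rev (Q u v);
  pg_mid : forall u v s t z z', e u v -> e s t -> [set u; v] != [set s; t] ->
    z \in segs (Q u v) -> z' \in segs (Q s t) -> segdisj z.1 z.2 z'.1 z'.2;
  pg_exit_mid : forall u v s t z, e u v -> e s t -> [set u; v] != [set s; t] ->
    z \in segs (Q s t) -> segdisj (pos u) (exit_pt u v) z.1 z.2;
  pg_exit_exit : forall u v s t, e u v -> e s t -> [set u; v] != [set s; t] ->
    u != s -> segdisj (pos u) (exit_pt u v) (pos s) (exit_pt s t);
  pg_exit_neq : forall u v, e u v -> exit_pt u v <> pos u;
  pg_exit_dir : forall u v t, e u v -> e u t -> v != t ->
    ~ pos_parallel (pos u) (exit_pt u v) (exit_pt u t)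
}.

Variable e : rel T.
Hypotheses (e_sym : symmetric e) (e_irr : irreflexive e).
Hypothesis drawn : polygonal_drawing e.

Definition edge_cross s t p :=
  crosses (pos s) (exit_pt s t) p (+) cross_path (Q s t) p (+)
  crosses (pos t) (exit_pt t s) p.

Let lt_rank (d : T * T) := (enum_rank d.1 < enum_rank d.2)%N.

(** The parity w(C, p); [lt_rank] selects one orientation of each edge. *)
Definition winding (C : {set {set T}}) p :=
  \big[addb/false]_(d : T * T | e d.1 d.2 && lt_rank d)
     (([set d.1; d.2] \in C) && edge_cross d.1 d.2 p).

Lemma winding_symdiff C D p : winding (symdiff C D) p = winding C p (+) winding D p.
Proof.
by rewrite /winding -big_split /=; apply: eq_bigr => d _; rewrite inE andb_addl.
Qed.

Lemma exit_last u v : e u v -> exit_pt v u = last (exit_pt u v) (Q u v).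
Proof.
move=> uv; rewrite /exit_pt (pg_rev drawn uv); have := pg_nonempty drawn uv.
by case: (Q u v) => [|q l] // _; rewrite lastI rev_rcons /= last_rcons.
Qed.

Lemma mid_switch s t p q : e s t ->
  (forall z, z \in segs (Q s t) -> segdisj z.1 z.2 p q) ->
  cross_path (Q s t) p (+) cross_path (Q s t) q =
  above p q (exit_pt s t) (+) above p q (exit_pt t s).
Proof.
move=> st; rewrite (exit_last st) /exit_pt; have := pg_nonempty drawn st.
by case: (Q s t) => [|a l] // _ /cross_path_switch.
Qed.

(** Passage from edges to half-edges, where contributions can be regrouped by vertex. *)
Lemma sum_ordered (h : T -> T -> bool) :
  \big[addb/false]_(d : T * T | e d.1 d.2 && lt_rank d) (h d.1 d.2 (+) h d.2 d.1) =
  \big[addb/false]_u \big[addb/false]_(v | e u v) h u v.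
Proof.
rewrite pair_big_dep /= big_split /= [RHS](bigID lt_rank) /=; congr (_ (+) _).
rewrite (reindex_inj (h := fun d : T * T => (d.2, d.1))) /=; last by move=> [? ?] [? ?] [-> ->].
apply: eq_bigl => -[u v] /=; rewrite e_sym /lt_rank /= -leqNgt ltn_neqAle.
case vu: (e u v) => //=; rewrite -[X in _ = X]andTb; congr (_ && _).
by rewrite (inj_eq val_inj) (inj_eq enum_rank_inj); apply: contraTneq vu => ->; rewrite e_irr.
Qed.

Lemma sum_edges_even C (g : T -> bool) : C \in cycle_space e ->
  \big[addb/false]_u \big[addb/false]_(v | e u v) (([set u; v] \in C) && g u) = false.
Proof.
move=> /(cycle_spaceP e_sym)[/subsetP CE Cev]; apply: big1 => u _.
case: (g u); last by apply: big1 => v _; rewrite andbF.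
under eq_bigr do rewrite andbT.
have := Cev u; rewrite odd_card_setE => /negbTE E; rewrite -[RHS]E [LHS]big_mkcond.
apply: eq_bigr => v _; case: ifP => // nuv.
by apply/esym; apply: contraFF nuv => /CE; rewrite mem_edges.
Qed.

Lemma edge_neq (C : {set {set T}}) u v s t :
  [set u; v] \notin C -> [set s; t] \in C -> [set s; t] != [set u; v].
Proof. by move=> uvC; apply: contraTneq => ->. Qed.

(** From [p] to [q], an edge of [C] changes its contribution by the [above] terms of its two ends.
    Every vertex thus occurs as often as its degree in [C], which is even. *)
Lemma winding_mid u v C p q : e u v -> C \in cycle_space e -> [set u; v] \notin C ->
  (p, q) \in segs (Q u v) -> winding C p (+) winding C q = false.
Proof.
move=> uv Cc uvC pq; rewrite -[RHS](sum_edges_even (fun s => above p q (pos s)) Cc).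
rewrite -sum_ordered /winding -big_split /=; apply: eq_bigr => -[s t] /= /andP[st _].
rewrite [[set t; s]]setUC; case stC: ([set s; t] \in C) => //=.
have neq := edge_neq uvC stC.
rewrite /edge_cross addbACA (addbACA (crosses _ _ _)) mid_switch //; last first.
  by move=> z zst; apply: (pg_mid drawn st uv neq zst pq).
rewrite !cross_switch.
- by move: (above p q _) (above p q _) (above p q _) (above p q _); do 4 case.
- have ts : e t s by rewrite e_sym.
  have neq' : [set t; s] != [set u; v] by rewrite setUC.
  exact: (pg_exit_mid drawn ts uv neq' pq).
exact: (pg_exit_mid drawn st uv neq pq).
Qed.

(** The winding parity in a sector at [v] next to the edge [vu], computed from [pos v] by adding the
    edges higher than [vu] in the same half-plane. This is linear in [C] and makes sense even when
    [C] contains [vu]. *)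
Definition side v u (C : {set {set T}}) := winding C (pos v) (+)
  \big[addb/false]_(t | e v t && higher (pos v) (exit_pt v t) (exit_pt v u))
     ([set v; t] \in C).

(** As in [winding_mid], the [above] terms cancel by evenness. The edges at [v] leave the defect [N]
    of [cross_radial], which is the correction in [side]. *)
Lemma winding_exit v u C : e v u -> C \in cycle_space e -> [set v; u] \notin C ->
  side v u C = winding C (exit_pt v u).
Proof.
move=> vu Cc vuC; set p := pos v; set y := exit_pt v u.
pose N s t := (s == v) && higher p (exit_pt s t) y.
pose h s t := ([set s; t] \in C) && (above p y (pos s) (+) N s t).
have key : winding C p (+) winding C y =
    \big[addb/false]_(d : T * T | e d.1 d.2 && lt_rank d) (h d.1 d.2 (+) h d.2 d.1).
  rewrite /winding -big_split /=; apply: eq_bigr => -[s t] /= /andP[st _].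
  rewrite /h [[set t; s]]setUC; case stC: ([set s; t] \in C) => //=.
  have neq := edge_neq vuC stC.
  rewrite /edge_cross addbACA (addbACA (crosses _ _ _)) mid_switch //; last first.
    move=> z zst; apply: segdisjC; apply: (pg_exit_mid drawn vu st _ zst).
    by rewrite eq_sym.
  have exitE a b : e a b -> [set a; b] != [set v; u] ->
      crosses (pos a) (exit_pt a b) p (+) crosses (pos a) (exit_pt a b) y =
      above p y (pos a) (+) N a b (+) above p y (exit_pt a b).
    move=> ab nab; rewrite /N; case: (eqVneq a v) => [->|av] /=.
      rewrite crosses_start above_start /= -cross_radial.
      by rewrite -addbA addbb addbF.
    rewrite addbF; apply: cross_switch; exact: (pg_exit_exit drawn ab vu nab av).
  have ts : e t s by rewrite e_sym.
  rewrite !exitE //; last by rewrite setUC.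
  move: (above p y (pos s)) (above p y (pos t)) (N s t) (N t s).
  by move: (above p y _) (above p y _); do 6 case.
suff E : \big[addb/false]_(d : T * T | e d.1 d.2 && lt_rank d) (h d.1 d.2 (+) h d.2 d.1) =
    \big[addb/false]_(t | e v t && higher p (exit_pt v t) y) ([set v; t] \in C).
  by rewrite /side -E -key addbA addbb.
rewrite sum_ordered /h; under eq_bigr do under eq_bigr do rewrite andb_addr.
under eq_bigr do rewrite big_split /=.
rewrite big_split /= (sum_edges_even (fun s => above p y (pos s)) Cc) /=.
rewrite (bigD1 v) //= [X in _ (+) X]big1 ?addbF.
  rewrite [RHS]big_mkcondr /=; apply: eq_bigr => t _.
  by rewrite /N eqxx /=; case: ifP => _; rewrite ?andbT ?andbF.
by move=> s sv; apply: big1 => t _; rewrite /N (negbTE sv) andbF.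
Qed.

(** Both sides are winding parities at the exit points of the edge, and the parity is constant along
    the polygon between these points. *)
Lemma side_off u v C : e u v -> C \in cycle_space e -> [set u; v] \notin C ->
  side u v C = side v u C.
Proof.
move=> uv Cc uvC; rewrite winding_exit // winding_exit //; last 2 first.
- by rewrite e_sym.
- by rewrite setUC.
rewrite (exit_last uv) /exit_pt; have := pg_nonempty drawn uv.
have := fun p q => @winding_mid u v C p q uv Cc uvC.
case: (Q u v) => [|q l] //= + _; elim: l q => [|b l IH] q h //=.
have /(congr1 (addb^~ (winding C b))) := h q b (mem_head _ _).
rewrite addbK /= => ->; apply: IH => p p' pp'; apply: h.
by rewrite /segs /= inE pp' orbT.
Qed.

Lemma side_symdiff u v C D : side u v (symdiff C D) = side u v C (+) side u v D.
Proof.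
rewrite /side winding_symdiff addbACA; congr (_ (+) _); rewrite -big_split /=.
by apply: eq_bigr => t _; rewrite inE.
Qed.

(** In each half-plane the sides telescope to [K] and [K] plus the sum over that half-plane. The two
    final functionals agree on cycles, since the degree at [v] is even, so everything cancels. *)
Lemma side_even v (f : {ffun {set {set T}} -> bool}) :
  \big[addb/false]_(u | e v u) ((restr e (side v u) == f) (+)
     (restr e (other_side side v u) == f)) = false.
Proof.
pose gt t u := higher (pos v) (exit_pt v t) (exit_pt v u).
pose G b := [set u | e v u & rightward (pos v) (exit_pt v u) == b].
pose x t C := [set v; t] \in (C : {set {set T}}).
pose K C := winding C (pos v).
have half b : \big[addb/false]_(u in G b) ((restr e (side v u) == f) (+)
     (restr e (other_side side v u) == f)) =
   (restr e K == f) (+) (restr e (fun C => K C (+) \big[addb/false]_(t in G b) x t C) == f).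
  have irr : irreflexive gt by move=> u; rewrite /gt higher_irr.
  have tr : {in G b & &, transitive gt} by move=> b' a c _ _ _; apply: higher_trans.
  have tot : {in G b &, forall u w, [|| u == w, gt u w | gt w u]}.
    move=> a c; rewrite !inE => /andP[va /eqP Ea] /andP[vc /eqP Ec].
    have [->|ac] := eqVneq a c; first by [].
    rewrite /= /gt; apply: higher_total; rewrite ?Ea ?Ec //.
    + exact: pg_exit_neq drawn _ _ va.
    + exact: pg_exit_neq drawn _ _ vc.
    + exact: (pg_exit_dir drawn va vc ac).
  have sideE u : u \in G b -> side v u =1 fun C =>
      K C (+) \big[addb/false]_(t in G b | gt t u) x t C.
    rewrite inE => /andP[vu /eqP ub] C; rewrite /side; congr (_ (+) _).
    apply: eq_bigl => t; rewrite inE -andbA; congr (_ && _).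
    by rewrite /gt /higher ub; case: (_ == b).
  refine (etrans _ (telescope_sides x [in cycle_space e] f K erefl irr tr tot)); cbv zeta.
  apply: eq_bigr => u uG; congr (_ (+) _); congr (_ == _); apply/ffunP => C.
    by rewrite !ffunE sideE.
  by rewrite !ffunE /other_side sideE.
rewrite (bigID (fun u => rightward (pos v) (exit_pt v u))) /=.
have split_G b : \big[addb/false]_(u in G b) ((restr e (side v u) == f) (+)
     (restr e (other_side side v u) == f)) =
  \big[addb/false]_(u | e v u && (rightward (pos v) (exit_pt v u) == b))
    ((restr e (side v u) == f) (+) (restr e (other_side side v u) == f)).
  by apply: eq_bigl => u; rewrite inE.
have := half true; have := half false; rewrite !split_G.
under [in X in X -> _]eq_bigl do rewrite eqbF_neg.
under [in X in _ -> X -> _]eq_bigl do rewrite eqb_id.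
move=> -> ->; rewrite addbACA addbb /=.
suff -> : restr e (fun C => K C (+) \big[addb/false]_(t in G true) x t C) =
  restr e (fun C => K C (+) \big[addb/false]_(t in G false) x t C) by rewrite addbb.
apply/ffunP => C; rewrite !ffunE; case Cc: (C \in cycle_space e) => //=; congr (_ (+) _).
have /(cycle_spaceP e_sym)[/subsetP CE /(_ v)] := Cc; rewrite odd_card_setE => /negbTE.
rewrite (bigID [in G true]) /=.
have -> : \big[addb/false]_(i | i \notin G true) ([set v; i] \in C) =
   \big[addb/false]_(i in G false) x i C.
  rewrite [LHS](bigID [in G false]) /= [X in _ (+) X]big1 ?addbF.
    apply: eq_bigl => t; rewrite !inE; case: (e v t) => //=.
    by case: (rightward _ _).
  move=> t; rewrite !inE; case vt: (e v t) => /=; first by case: (rightward _ _).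
  by move=> _; apply: contraFF vt => /CE; rewrite mem_edges.
rewrite -/(\big[addb/false]_(t in G true) x t C).
by case: (\big[_/_]_(_ in G true) _); case: (\big[_/_]_(_ in G false) _).
Qed.

Lemma polygonal_faces (S : {set T}) : (forall u v, e u v -> u \in S) ->
  exists BB : {set {set {set T}}},
  [/\ {in BB, forall B, B \in cycle_space e /\ B != set0},
      forall x, x \in edges e -> (#|[set B in BB | x \in B]| <= 2)%N &
      (#|edges e| <= #|BB| + #|S|)%N].
Proof.
exact: (face_family e_sym e_irr side_symdiff side_off side_even).
Qed.

End Polygonal.

(** * Approximation of arcs by polygons *)

Require Import Defs.
From mathcomp Require Import all_boot all_order all_algebra.
From mathcomp Require Import all_classical all_reals all_analysis.
Import numFieldNormedType.Exports.

(** * Distance estimates that keep segments apart *)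

Section Metric.
Local Open Scope ring_scope.
Variable R : realType.
Implicit Types (a b p q u v : R * R) (d r : R).

Lemma segdisj_vec a b p q :
  (forall s t : R, 0 <= s <= 1 -> 0 <= t <= 1 ->
     a + s *: (b - a) = p + t *: (q - p) -> False) -> segdisj a b p q.
Proof.
move=> h s t hs ht E1 E2; apply: (h s t hs ht).
by rewrite [LHS]surjective_pairing [RHS]surjective_pairing; congr pair.
Qed.

Lemma norm_scale_unit (t : R) v d : 0 <= t <= 1 -> `|v| < d -> `|t *: v| < d.
Proof.
move=> /andP[t0 t1]; apply: le_lt_trans; rewrite normrZ ger0_norm //.
by rewrite ler_piMl.
Qed.

Lemma far_mid_disj a b p q d : `|a - b| < d -> `|p - q| < d -> 2 * d <= `|a - p| ->
  segdisj a b p q.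
Proof.
move=> ab pq ap; apply: segdisj_vec => s t hs ht E.
have E' : a - p = t *: (q - p) - s *: (b - a).
  by apply/eqP; rewrite subr_eq addrAC [_ + p]addrC -E addrK.
move: ap; rewrite leNgt => /negP; apply; rewrite E'.
apply: le_lt_trans (ler_normB _ _) _; rewrite mulrDl mul1r.
by apply: ltrD; apply: norm_scale_unit; rewrite // distrC.
Qed.

(** A common point [z] is within [d] of [p], so farther than [r - d] from [u]. As [z] lies between
    [u] and [a], it is then within [2 * d] of [a], contradicting the distance from [a] to [p]. *)
Lemma exit_mid_disj u a p q r d : r < `|p - u| -> `|p - q| < d ->
  `|a - u| <= r + d -> 3 * d <= `|a - p| -> segdisj u a p q.
Proof.
move=> pu pq au ap; apply: segdisj_vec => s t hs ht E.
set z := u + s *: (a - u) in E.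
have zp : `|z - p| < d by rewrite E addrC addKr; apply: norm_scale_unit; rewrite // distrC.
have zu : `|z - u| = s * `|a - u|.
  by rewrite /z addrC addKr normrZ ger0_norm //; case/andP: hs.
have za : `|a - z| = (1 - s) * `|a - u|.
  have -> : a - z = (1 - s) *: (a - u) by rewrite scalerBl scale1r /z opprD addrA.
  by rewrite normrZ ger0_norm //; case/andP: hs => _; rewrite subr_ge0.
have h1 := ler_distD z p u; have h2 := ler_distD z a p.
rewrite (distrC p z) in h1; move: h1 h2; rewrite zu za.
by move: zp pu ap au; clear; lra.
Qed.

Lemma exit_exit_disj u a v b d : `|a - u| <= d -> `|b - v| <= d -> 2 * d < `|u - v| ->
  segdisj u a v b.
Proof.
move=> au bv uv; apply: segdisj_vec => s t hs ht E.
set z := u + s *: (a - u) in E.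
have small t' w : 0 <= t' <= 1 -> `|w| <= d -> `|t' *: w| <= d.
  by case/andP=> t0 t1; apply: le_trans; rewrite normrZ ger0_norm // ler_piMl.
have zu : `|z - u| <= d by rewrite /z addrC addKr; apply: small.
have zv : `|z - v| <= d by rewrite E addrC addKr; apply: small.
have := ler_distD z u v; rewrite (distrC u z).
by move: zu zv uv; clear; lra.
Qed.

(** For points on one ray from [u], the distance is the difference of their distances to [u], here
    less than [d]. *)
Lemma exit_dir u a b r d : r < `|a - u| <= r + d -> r < `|b - u| <= r + d ->
  d < `|a - b| -> ~ pos_parallel u a b.
Proof.
move=> ha hb ab [k k0 [E1 E2]].
have E : a - u = k *: (b - u).
  by rewrite [LHS]surjective_pairing [RHS]surjective_pairing; congr pair.
have nau : `|a - u| = k * `|b - u| by rewrite E normrZ gtr0_norm.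
have nab : `|a - b| = `|k - 1| * `|b - u|.
  have -> : a - b = (k - 1) *: (b - u); last by rewrite normrZ.
  by rewrite scalerBl scale1r -E opprB addrA subrK.
have nab' : `|a - b| = `| `|a - u| - `|b - u| |.
  by rewrite nab nau -[X in _ = `|_ - X|]mul1r -mulrBl normrM normr_id.
move: ab; rewrite nab'; move: ha hb; move: `|a - u| `|b - u| => x y; clear.
by case: (lerP 0 (x - y)) => h; rewrite ?(ger0_norm h) ?(ltr0_norm h); lra.
Qed.

(** Yields one threshold valid for all vertices and edges at once. *)
Lemma finite_min (I : finType) (P : I -> R -> Prop) :
  (forall i r r', 0 < r' -> r' <= r -> P i r -> P i r') ->
  (forall i, exists2 r, 0 < r & P i r) -> exists2 r, 0 < r & forall i, P i r.
Proof.
move=> down h.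
have [r r0 H] : exists2 r, 0 < r & forall i, i \in enum I -> P i r.
  elim: (enum I) => [|i s [r r0 IH]]; first by exists 1.
  have [r' r'0 Pr'] := h i; exists (Num.min r r') => [|j].
    by rewrite lt_min r0.
  have m0 : 0 < Num.min r r' by rewrite lt_min r0.
  rewrite inE => /orP[/eqP ->|js].
    by apply: down Pr' => //; rewrite ge_min lexx orbT.
  by apply: down (IH _ js) => //; rewrite ge_min lexx.
by exists r => // i; apply: H; rewrite mem_enum.
Qed.


End Metric.

(** * Consequences of compactness *)

Section Compactness.
Local Open Scope ring_scope.
Variable R : realType.
Local Open Scope classical_set_scope.

Lemma compact_dist (A B : set (R * R)) : compact A -> compact B ->
  (forall x, A x -> B x -> False) ->
  exists2 d : R, 0 < d & forall x y, A x -> B y -> d <= `|x - y|.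
Proof.
move=> cA cB AB.
have [[x0 Ax0]|/forallNP nA] := pselect (exists x, A x); last first.
  by exists 1 => // x y /nA.
have [[y0 By0]|/forallNP nB] := pselect (exists y, B y); last first.
  by exists 1 => // x y _ /nB.
pose f (z : (R * R) * (R * R)) : R := `|z.1 - z.2|.
have fc : continuous f.
  move=> z; rewrite /f; apply: cvg_norm; apply: cvgB; [exact: cvg_fst|exact: cvg_snd].
have [|||c] := @compact_EVT_min _ R f (A `*` B).
- by exists (x0, y0).
- exact: compact_setX.
- exact: continuous_subspaceT.
rewrite inE => -[Ac Bc] cmin; exists (f c) => [|x y Ax By].
  rewrite /f normr_gt0 subr_eq0; apply/eqP => E; apply: (AB c.1) => //.
  by rewrite E.
by have := cmin (x, y); apply; rewrite inE.
Qed.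

Lemma unif_cont01 (f : R -> R * R) (d : R) : 0 < d ->
  ({within `[0, 1], continuous f}) ->
  exists2 r : R, 0 < r & forall s t : R, 0 <= s <= 1 -> 0 <= t <= 1 -> `|s - t| < r ->
    `|f s - f t| < d.
Proof.
move=> d0 fc.
have /compact_near_coveringP/near_covering_withinP cov := @segment_compact R 0 1.
pose P (r : R) (x : R) := forall t : R, 0 <= t <= 1 -> `|x - t| < r -> `|f x - f t| < d.
have : \forall r \near 0^'+, (`[0, 1] `<=` P r).
  apply: cov => x; rewrite /= in_itv /= => x01.
  have /subspace_continuousP/(_ x) := fc; rewrite /= in_itv /= => /(_ x01).
  move=> /cvgrPdist_lt/(_ (d / 2)); rewrite divr_gt0 // => /(_ isT).
  rewrite near_withinE => /nbhs_ballP[e /= e0 he].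
  have near_e z : 0 <= z <= 1 -> `|x - z| < e -> `|f x - f z| < d / 2.
    by move=> z01 xz; apply: he => //=; rewrite in_itv.
  exists (ball x (e / 2), [set r | 0 < r < e / 2]) => /=.
    split; first by apply: nbhsx_ballx; rewrite divr_gt0.
    have e20 : 0 < e / 2 by rewrite divr_gt0.
    near=> r; apply/andP; split; first by near: r; exact: nbhs_right_gt.
    by near: r; exact: nbhs_right_lt.
  move=> [z r] /= [xz /andP[r0 re]]; rewrite in_itv /= => z01 t t01 zt.
  have {}xz : `|x - z| < e / 2 := xz.
  have h1 := near_e z z01 ltac:(by clear -xz e0; lra).
  have h2 : `|f x - f t| < d / 2.
    apply: near_e => //; apply: le_lt_trans (ler_distD z _ _) _.
    by clear -xz zt re; lra.
  apply: le_lt_trans (ler_distD (f x) _ _) _; rewrite (distrC (f z)).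
  by clear -h1 h2; lra.
move=> near_P; near (0 : R)^'+ => r.
exists r => [|s t s01 t01]; first by near: r; exact: nbhs_right_gt.
have : `[0, 1] `<=` P r by near: r.
by apply=> //=; rewrite in_itv.
Unshelve. all: by end_near. Qed.

End Compactness.

(** * Polygons from samples of an arc *)

Section Sampling.
Local Open Scope ring_scope.
Variable R : realType.

Definition near_rel (d : R) : rel (R * R) := fun a b => `|a - b| < d.

Lemma segs_sorted d (l : seq (R * R)) z : sorted (near_rel d) l -> z \in segs l ->
  [/\ `|z.1 - z.2| < d, z.1 \in l & z.2 \in l].
Proof.
elim: l => [|a [|b l] IH] //= /andP[ab sl].
rewrite /segs /= inE => /orP[/eqP -> /=|/(IH sl)[h1 h2 h3]].
  by split=> //; rewrite !inE eqxx ?orbT.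
by split=> //; rewrite inE ?h2 ?h3 orbT.
Qed.

(** The samples kept lie strictly between the last index [i0] near [u] and the first later index
    [j0] near [v], so they avoid both discs while the first and last ones are at most one step
    outside. *)
Lemma sample_path (f : nat -> R * R) N u v (r d : R) :
  f 0%N = u -> f N = v -> (forall i, (i < N)%N -> `|f i - f i.+1| < d) ->
  0 < d -> d <= r -> 4 * r < `|u - v| ->
  exists l : seq (R * R), [/\ l != [::],
    forall z, z \in l -> [/\ exists2 i, (i <= N)%N & z = f i, r < `|z - u| & r < `|z - v|],
    sorted (near_rel d) l, `|head u l - u| <= r + d & `|last v l - v| <= r + d].
Proof.
move=> f0 fN fd d0 dr uv.
pose P i := (i <= N)%N && (`|f i - u| <= r).
have Pex : exists i, P i by exists 0%N; rewrite /P /= f0 subrr normr0; lra.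
have Pub i : P i -> (i <= N)%N by case/andP.
case: (ex_maxnP Pex Pub) => i0 /andP[i0N i0u] i0max.
have i0N' : (i0 < N)%N.
  rewrite ltn_neqAle i0N andbT; apply/eqP => E; move: i0u; rewrite E fN distrC.
  by clear -uv dr d0; lra.
pose Q j := [&& (i0 < j)%N, (j <= N)%N & `|f j - v| <= r].
have Qex : exists j, Q j by exists N; rewrite /Q i0N' leqnn fN subrr normr0; lra.
case: (ex_minnP Qex) => j0 /and3P[ij0 j0N j0v] j0min.
have after i : (i0 < i <= N)%N -> r < `|f i - u|.
  move=> /andP[h1 h2]; rewrite ltNge; apply/negP => h; have := i0max i.
  by rewrite /P h2 h leqNgt h1 => /(_ isT).
have before j : (i0 < j < j0)%N -> r < `|f j - v|.
  move=> /andP[h1 h2]; rewrite ltNge; apply/negP => h; have := j0min j.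
  by rewrite /Q h1 h (leq_trans (ltnW h2) j0N) leqNgt h2 => /(_ isT).
have hd_u : `|f i0.+1 - u| <= r + d.
  apply: le_trans (ler_distD (f i0) _ _) _; rewrite addrC lerD // ltW // distrC.
  exact: fd.
(* Some sample remains: otherwise [u] and [v] would be within [2 * r + d <= 3 * r]. *)
have ij1 : (i0.+1 < j0)%N.
  rewrite ltn_neqAle ij0 andbT; apply/eqP => E; move: j0v; rewrite -E => j0v.
  have := ler_distD (f i0.+1) u v; rewrite (distrC u (f _)) => h.
  by clear -j0v hd_u uv dr d0 h; lra.
have lE : iota i0.+1 (j0 - i0.+1) = i0.+1 :: iota i0.+2 (j0 - i0.+2).
  by rewrite -[(j0 - i0.+1)%N]prednK ?subn_gt0 //= -subnS.
exists (map f (iota i0.+1 (j0 - i0.+1))); split.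
- by rewrite lE.
- move=> z /mapP[i]; rewrite mem_iota subnKC ?(ltnW ij1) // => /andP[h1 h2] ->; split.
  + by exists i => //; apply: leq_trans (ltnW h2) j0N.
  + by apply: after; rewrite h1 (leq_trans (ltnW h2) j0N).
  + by apply: before; rewrite h1.
- apply/(sortedP u) => i; rewrite size_map size_iota => hi.
  rewrite !(nth_map 0%N) ?size_iota ?(ltnW hi) // !nth_iota ?(ltnW hi) // addnS.
  apply: fd; apply: leq_trans j0N; rewrite -ltn_subRL in hi *.
  by move: hi; rewrite ltn_subRL addnS => /ltnW; rewrite -ltn_subRL.
- by rewrite lE.
have -> : last v (map f (iota i0.+1 (j0 - i0.+1))) = f j0.-1.
  rewrite -nth_last size_map size_iota (nth_map 0%N) ?size_iota ?ltn_predL ?subn_gt0 //.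
  rewrite nth_iota ?ltn_predL ?subn_gt0 //; congr f.
  by clear -ij1; lia.
apply: le_trans (ler_distD (f j0) _ _) _; rewrite addrC lerD // ltW //.
have := fd j0.-1; rewrite prednK ?(leq_ltn_trans _ ij1) //; exact.
Qed.

End Sampling.

(** * From a plane drawing to a polygonal one *)

Section Approximation.
Local Open Scope ring_scope.
Variables (R : realType) (T : finType) (e : rel T).
Variables (pos : T -> R * R) (arc : T -> T -> R -> R * R).
Hypotheses (e_sym : symmetric e) (e_irr : irreflexive e).
Hypothesis drawn : plane_drawing e pos arc.

Let arc_image u v : set (R * R) := (arc u v @` `[0, 1])%classic.

Lemma compact_arc u v : e u v -> compact (arc_image u v).
Proof.
move=> uv; apply: continuous_compact; first exact: pd_cont drawn u v uv.
exact: segment_compact.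
Qed.

Lemma vertex_radius : exists2 r : R, 0 < r &
  (forall u v, u != v -> 4 * r < `|pos u - pos v|) /\
  (forall u v w t, e u v -> w != u -> w != v -> 0 <= t <= 1 -> r < `|arc u v t - pos w|).
Proof.
have [r1 r10 h1] : exists2 r : R, 0 < r & forall p : T * T, p.1 != p.2 ->
    4 * r < `|pos p.1 - pos p.2|.
  apply: finite_min => [[u v] r r' r'0 rr' /= h /h|[u v] /=]; first by lra.
  have [_|uv] := eqVneq u v; first by exists 1.
  have n0 : 0 < `|pos u - pos v|.
    by rewrite normr_gt0 subr_eq0; apply: contra_neq uv; apply: (pd_pos_inj drawn).
  by exists (`|pos u - pos v| / 8) => [|_]; lra.
have [r2 r20 h2] : exists2 r : R, 0 < r & forall p : T * T * T,
    e p.1.1 p.1.2 -> p.2 != p.1.1 -> p.2 != p.1.2 -> forall t, 0 <= t <= 1 ->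
    r < `|arc p.1.1 p.1.2 t - pos p.2|.
  apply: finite_min => [[[u v] w] r r' r'0 rr' /= h uv wu wv t t01|[[u v] w] /=].
    exact: le_lt_trans rr' (h uv wu wv t t01).
  have [|uv] := boolP (e u v); last by exists 1.
  have [_|wu] := eqVneq w u; first by exists 1.
  have [_|wv] := eqVneq w v; first by exists 1.
  move=> uv; have [|d d0 hd] := compact_dist (compact_arc uv) (@compact_set1 _ (pos w)).
    move=> x [t /=]; rewrite in_itv /= => /andP[]; rewrite le_eqVlt => /orP[/eqP <- _|t0].
      by rewrite (pd_src drawn uv) => <- /(pd_pos_inj drawn)/esym/eqP; rewrite (negbTE wu).
    rewrite le_eqVlt => /orP[/eqP ->|t1].
      by rewrite (pd_tgt drawn uv) => <- /(pd_pos_inj drawn)/esym/eqP; rewrite (negbTE wv).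
    by move=> <-; apply: (pd_avoid drawn uv); rewrite in_itv /= t0.
  exists (d / 2) => [|_ _ _ t t01]; first by lra.
  have := hd (arc u v t) (pos w); move=> /(_ _ erefl) h.
  have {}h : d <= `|arc u v t - pos w| by apply: h; exists t => //=; rewrite in_itv.
  by lra.
exists (Num.min r1 r2); rewrite ?lt_min ?r10 //; split=> [u v uv|u v w t uv wu wv t01].
  apply: le_lt_trans (h1 (u, v) uv); rewrite ler_pM2l ?ge_min ?lexx //.
by apply: le_lt_trans (h2 (u, v, w) uv wu wv t t01); rewrite ge_min lexx orbT.
Qed.

(** Outside the open discs of radius [r] around the vertices only interior points of arcs remain, so
    distinct edges give disjoint compact sets. *)
Lemma arcs_apart (r : R) : 0 < r -> exists2 d : R, 0 < d &
  forall u v x y, e u v -> e x y -> [set u; v] != [set x; y] ->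
  forall s t, 0 <= s <= 1 -> 0 <= t <= 1 ->
  (forall w, r <= `|arc u v s - pos w|) -> (forall w, r <= `|arc x y t - pos w|) ->
  d <= `|arc u v s - arc x y t|.
Proof.
move=> r0; pose far : set (R * R) := (\bigcap_w [set z | r <= `|z - pos w|])%classic.
have far_closed : closed far.
  apply: closed_bigI => w _.
  have c : continuous (fun z : R * R => `|z - pos w| : R).
    by move=> z; apply: cvg_norm; apply: cvgB; [exact: cvg_id|exact: cvg_cst].
  exact: (closed_comp (fun z _ => c z) (@closed_ge R r)).
have inner u v s : e u v -> 0 <= s <= 1 -> far (arc u v s) -> 0 < s < 1.
  move=> uv /andP[s0 s1] h; rewrite !lt_neqAle s0 s1 !andbT.
  apply/andP; split; apply/eqP => E.
    have /= := h u I; rewrite -E (pd_src drawn uv) subrr normr0; by lra.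
  have /= := h v I; rewrite E (pd_tgt drawn uv) subrr normr0; by lra.
have [d d0 hd] : exists2 d : R, 0 < d & forall p : (T * T) * (T * T),
    e p.1.1 p.1.2 -> e p.2.1 p.2.2 -> [set p.1.1; p.1.2] != [set p.2.1; p.2.2] ->
    forall z z', (arc_image p.1.1 p.1.2 `&` far)%classic z ->
      (arc_image p.2.1 p.2.2 `&` far)%classic z' -> d <= `|z - z'|.
  apply: finite_min => [p d d' d'0 dd' h uv xy n z z' hz hz'|[[u v] [x y]] /=].
    exact: le_trans dd' (h uv xy n z z' hz hz').
  have [uv|] := boolP (e u v); last by exists 1.
  have [xy|] := boolP (e x y); last by exists 1.
  have [_|n] := eqVneq [set u; v] [set x; y]; first by exists 1.
  have cA a b (ab : e a b) := compact_closedI (compact_arc ab) far_closed.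
  have [|d d0 hd] := compact_dist (cA _ _ uv) (cA _ _ xy); last by exists d.
  move=> z [[s /=]]; rewrite in_itv /= => s01 sz fz [[t /=]]; rewrite in_itv /= => t01 tz _.
  have s01' : s \in `]0, 1[ by rewrite in_itv /= (inner u v) // sz.
  have t01' : t \in `]0, 1[ by rewrite in_itv /= (inner x y) // tz.
  have := pd_disj drawn uv xy s01' t01' (etrans sz (esym tz)).
  by case=> -[? ?]; subst; move: n; rewrite ?eqxx // finset.setUC eqxx.
exists d => // u v x y uv xy n s t s01 t01 hs ht.
apply: (hd ((u, v), (x, y))) => //=; split.
- by exists s => //=; rewrite in_itv.
- by move=> w _; apply: hs.
- by exists t => //=; rewrite in_itv.
- by move=> w _; apply: ht.
Qed.

Lemma arc_mesh (d : R) : 0 < d -> exists2 N : nat, (0 < N)%N &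
  forall u v i, e u v -> (i < N)%N -> `|arc u v (i%:R / N%:R) - arc u v (i.+1%:R / N%:R)| < d.
Proof.
move=> d0; have [r r0 hr] : exists2 r : R, 0 < r & forall p : T * T, e p.1 p.2 ->
    forall s t : R, 0 <= s <= 1 -> 0 <= t <= 1 -> `|s - t| < r ->
    `|arc p.1 p.2 s - arc p.1 p.2 t| < d.
  apply: finite_min => [p r r' r'0 rr' h uv s t s01 t01 st|[u v] /=].
    by apply: h => //; apply: lt_le_trans rr'.
  have [uv|] := boolP (e u v); last by exists 1.
  by have [r r0 hr] := unif_cont01 d0 (pd_cont drawn uv); exists r.
pose N := (Num.truncn r^-1).+1; exists N => // u v i uv iN.
have N0 : 0 < N%:R :> R by rewrite ltr0n.
have frac j : (j <= N)%N -> 0 <= (j%:R / N%:R : R) <= 1.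
  by move=> jN; rewrite divr_ge0 //= ler_pdivrMr // mul1r ler_nat.
apply: (hr (u, v)); rewrite ?frac // 1?ltnW //=.
rewrite distrC -mulrBl -natrB // subSnn mul1r ger0_norm ?invr_ge0 ?ltW //.
by rewrite invf_plt ?posrE // truncnS_gt.
Qed.

Lemma polygonal_approximation : exists Q, polygonal_drawing pos Q e.
Proof.
have [r r0 [posr arcr]] := vertex_radius.
have [d3 d30 apart] := arcs_apart r0.
(* The third of [d3] serves [exit_mid_disj]; [d <= r] serves [sample_path] and gives
   [2 * (r + d) <= 4 * r], as needed for exits at different vertices. *)
pose d := Num.min (d3 / 3) r.
have d0 : 0 < d by rewrite lt_min r0 andbT; lra.
have dr : d <= r by rewrite ge_min lexx orbT.
have d3d : 3 * d <= d3.
  have : d <= d3 / 3 by rewrite ge_min lexx.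
  by lra.
have [N N0 mesh] := arc_mesh d0.
pose adm u v (l : seq (R * R)) := [/\ l != [::],
    forall z, z \in l -> (exists2 s, 0 <= s <= 1 & z = arc u v s) /\
                        (forall w, r < `|z - pos w|),
    sorted (near_rel d) l, `|head (pos u) l - pos u| <= r + d &
    `|last (pos v) l - pos v| <= r + d].
have adm_ex (p : T * T) : exists l, e p.1 p.2 -> adm p.1 p.2 l.
  case: p => u v /=; have [uv|] := boolP (e u v); last by exists [::].
  have nuv : u != v by apply: contraTneq uv => ->; rewrite e_irr.
  have [||i iN|l [l0 lin ls lh ll]] := @sample_path R
    (fun i => arc u v (i%:R / N%:R)) N (pos u) (pos v) r d _ _ _ d0 dr (posr u v nuv).
  - by rewrite mul0r (pd_src drawn uv).
  - by rewrite divff ?pnatr_eq0 -?lt0n // (pd_tgt drawn uv).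
  - exact: mesh.
  exists l => _; split=> // z /lin[[i iN ->] zu zv].
  have i01 : 0 <= (i%:R / N%:R : R) <= 1.
    by rewrite divr_ge0 //= ler_pdivrMr ?ltr0n // mul1r ler_nat.
  split=> [|w]; first by exists (i%:R / N%:R).
  have [->//|wu] := eqVneq w u; have [->//|wv] := eqVneq w v.
  exact: arcr.
have [Q0 HQ0] := choice adm_ex.
(* One polygon is chosen per edge and reversed for the other orientation, so that [pg_rev] holds
   exactly. *)
pose Q u v := if (enum_rank u < enum_rank v)%N then Q0 (u, v) else rev (Q0 (v, u)).
have adm_rev u v l : e u v -> adm u v l -> adm v u (rev l).
  move=> uv [l0 lin ls lh ll]; split.
  - by rewrite -size_eq0 size_rev size_eq0.
  - move=> z; rewrite mem_rev => /lin[[s s01 ->] h]; split=> //.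
    exists (1 - s); first by lra.
    by rewrite (pd_rev drawn uv) ?in_itv /=; [congr arc|]; lra.
  - rewrite rev_sorted; apply: sub_sorted ls => a b.
    by rewrite /near_rel distrC.
  - by case/lastP: l l0 {lin ls lh} ll => // l z _; rewrite rev_rcons last_rcons.
  - by case: l l0 {lin ls ll} lh => // z l _; rewrite rev_cons last_rcons.
have admQ u v : e u v -> adm u v (Q u v).
  move=> uv; rewrite /Q; case: ifP => _; first exact: (HQ0 (u, v)).
  have vu : e v u by rewrite e_sym.
  exact: adm_rev vu (HQ0 (v, u) vu).
have exitP u v : e u v -> exit_pt pos Q u v \in Q u v /\
    r < `|exit_pt pos Q u v - pos u| <= r + d.
  move=> uv; have [l0 lin _ lh _] := admQ u v uv.
  have m : exit_pt pos Q u v \in Q u v.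
    by rewrite /exit_pt; case: (Q u v) l0 => // a l _; rewrite mem_head.
  by split=> //; rewrite lh andbT; have [_] := lin _ m.
have far u v s t z z' : e u v -> e s t -> [set u; v] != [set s; t] ->
    z \in Q u v -> z' \in Q s t -> 3 * d <= `|z - z'|.
  move=> uv st n; have [_ lin _ _ _] := admQ u v uv; have [_ lin' _ _ _] := admQ s t st.
  move=> /lin[[a a01 ->] h] /lin'[[b b01 ->] h']; apply: le_trans d3d _.
  by apply: apart => // w; apply: ltW.
exists Q; split.
- by move=> u v /admQ[].
- move=> u v uv; rewrite /Q; case: ltngtP => // [_|E]; first by rewrite revK.
  by move: uv; rewrite (enum_rank_inj (val_inj E)) e_irr.
- move=> u v s t z z' uv st n zu zs.
  have [_ _ so _ _] := admQ u v uv; have [_ _ so' _ _] := admQ s t st.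
  have [zz m _] := segs_sorted so zu; have [zz' m' _] := segs_sorted so' zs.
  apply: far_mid_disj zz zz' _.
  have := far u v s t _ _ uv st n m m'; by lra.
- move=> u v s t z uv st n zs.
  have [_ lin so _ _] := admQ s t st; have [zz m _] := segs_sorted so zs.
  have [me /andP[_ eu]] := exitP u v uv.
  apply: exit_mid_disj zz eu _; first by have [_] := lin _ m.
  exact: far uv st n me m.
- move=> u v s t uv st n us.
  have [_ /andP[_ eu]] := exitP u v uv; have [_ /andP[_ es]] := exitP s t st.
  apply: exit_exit_disj eu es _; have := posr u s us; by lra.
- move=> u v uv E; have [_ /andP[]] := exitP u v uv.
  by rewrite E subrr normr0; lra.
- move=> u v t uv ut vt; have [mv ev] := exitP u v uv; have [mt et] := exitP u t ut.
  apply: exit_dir ev et _.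
  have n : [set u; v] != [set u; t] by apply: contra_neq vt; apply: edge_inj.
  have := far u v u t _ _ uv ut n mv mt; by lra.
Qed.

End Approximation.

Theorem theorem3p3 (R : realType) (T : finType) (e : rel T)
  (e_sym : symmetric e) (e_irr : irreflexive e)
  (e_planar : planar R e)
  (no_C3 : ~ has_kcycle e 3) (no_C4 : ~ has_kcycle e 4)
  (no_C6 : ~ has_kcycle e 6) :
  colorable0 e 45.
Proof.
have [pos [arc drawn]] := e_planar.
have no_short c : ucycle e c -> size c != 3 /\ size c != 4 /\ size c != 6.
  by move=> uc; split; [|split]; apply/eqP => E;
    [apply: no_C3|apply: no_C4|apply: no_C6]; exists c.
have no_triangle a b c : e a b -> e b c -> e c a -> False.
  move=> ab bc ca; have := no_short [:: a; b; c].
  rewrite /ucycle /= ab bc ca !inE.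
  have neq x y : e x y -> (x == y) = false by apply: contraTF => /eqP ->; rewrite e_irr.
  by rewrite (neq a b) // (neq b c) // eq_sym (neq c a) // => /(_ isT)[].
(* A subgraph is drawn by the same points and arcs. *)
have sub_faces (e' : rel T) (S : {set T}) :
  symmetric e' -> subrel e' e -> (forall u v, e' u v -> u \in S) ->
  exists BB : {set {set {set T}}},
  [/\ {in BB, forall B, B \in cycle_space e' /\ B != finset.set0},
      forall x, x \in edges e' -> (#|[set B in BB | x \in B]| <= 2)%N &
      (#|edges e'| <= #|BB| + #|S|)%N].
  move=> sym' sub eS.
  have irr' : irreflexive e' by move=> x; apply/negP => /sub; rewrite e_irr.
  have drawn' : plane_drawing e' pos arc.
    case: drawn => h1 h2 h3 h4 h5 h6 h7 h8; split=> //.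
    - by move=> u v /sub; apply: h2.
    - by move=> u v /sub; apply: h3.
    - by move=> u v /sub; apply: h4.
    - by move=> u v /sub; apply: h5.
    - by move=> u v /sub; apply: h6.
    - by move=> u v w /sub; apply: h7.
    - by move=> u v x y /sub uv /sub; apply: h8.
  have [Q drawnQ] := polygonal_approximation sym' irr' drawn'.
  exact: (polygonal_faces sym' irr' drawnQ eS).
have [A [_ Aind Adeg]] :=
  exists_good_part e_sym e_irr no_triangle no_short sub_faces [set: T].
exists A; split=> //; apply/bigmax_leqP => v vA.
have E : (~: A = [set: T] :\: A)%SET by rewrite finset.setTD.
by rewrite E; apply: Adeg; rewrite -E.
Qed.
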